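(* Let $G$ be a group, $N$ a normal subgroup of $G$ with inclusion $i\colon N\hookrightarrow G$, and $\Gamma=G/N$. If $\Gamma$ is boundedly $3$-acyclic, then \[ \dim\big(\mathrm{Q}(N)^G/i^*\mathrm{Q}(G)\big)\le\dim\mathrm{H}^2(\Gamma). \] Moreover, if in addition $G$ is Gromov-hyperbolic, then \[ \dim\big(\mathrm{Q}(N)^G/i^*\mathrm{Q}(G)\big)=\dim\mathrm{H}^2(\Gamma). \]
   Context: A quasimorphism on a group $G$ is a function $f\colon G\to\mathbb{R}$ with $\sup_{x,y\in G}|f(xy)-f(x)-f(y)|<\infty$; it is homogeneous if $f(x^n)=n f(x)$ for all $x\in G$, $n\in\mathbb{Z}$. $\mathrm{Q}(G)$ is the real vector space of homogeneous quasimorphisms on $G$. For a normal subgroup $N$ of $G$ with inclusion $i$: $\mathrm{Q}(N)^G$ is the space of $f\in\mathrm{Q}(N)$ with $f(gxg^{-1})=f(x)$ for all $g\in G$, $x\in N$; $i^*\mathrm{Q}(G)\subseteq\mathrm{Q}(N)^G$ is the space of restrictions to $N$ of elements of $\mathrm{Q}(G)$. $\mathrm{H}^n(\cdot)$ denotes group cohomology with trivial real coefficients and $\mathrm{H}^n_b(\cdot)$ bounded cohomology with trivial real coefficients (the cohomology of the subcomplex of bounded functions in the inhomogeneous complex of functions $G^{\times n}\to\mathbb{R}$). A group $\Gamma$ is boundedly $k$-acyclic if $\mathrm{H}^j_b(\Gamma)=0$ for every integer $j$ with $1\le j\le k$. *)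

(* Defs.v *)
From HB Require Import structures.
From mathcomp Require Import all_boot all_order all_algebra.
From mathcomp Require Import all_classical reals ring.

Set Implicit Arguments.
Unset Strict Implicit.
Unset Printing Implicit Defensive.

Import Order.TTheory GRing.Theory Num.Theory.

Local Open Scope ring_scope.
Local Open Scope quotient_scope.

(* Quotient.quot expects a zmodClosed predicate, from which submodClosed does *)
(* not inherit, hence the copy zmod_of of U.                                  *)

Section QuotientSpace.
Variables (R : pzRingType) (V : lmodType R) (U : submodClosed V).

Definition zmod_of : {pred V} := fun x => x \in U.

Lemma zmod_of_closed : zmod_closed zmod_of.
Proof. exact: GRing.submod_closedB (GRing.submodClosedP U). Qed.

HB.instance Definition _ := GRing.isZmodClosed.Build V zmod_of zmod_of_closed.

Definition lquot := Quotient.quot zmod_of.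

HB.instance Definition _ := GRing.Zmodule.on lquot.
HB.instance Definition _ := EqQuotient.on lquot.
HB.instance Definition _ := ZmodQuotient.on lquot.

Definition lquot_scale (a : R) : lquot -> lquot := lift_op1 lquot ( *:%R a).

Lemma pi_scale a : {morph \pi_lquot : x / a *: x >-> lquot_scale a x}.
Proof.
move=> x; unlock lquot_scale; apply/eqP; rewrite piE Quotient.equivE -scalerBr.
have: x - repr (\pi_lquot x) \in zmod_of.
  by rewrite (Quotient.idealrBE zmod_of) reprK.
exact: (@rpredZ _ _ U).
Qed.
Canonical pi_scale_morph a := PiMorph1 (pi_scale a).

Lemma lquot_scaleA a b v :
  lquot_scale a (lquot_scale b v) = lquot_scale (a * b) v.
Proof. by rewrite -[v]reprK !piE scalerA. Qed.

Lemma lquot_scale1 : left_id 1 lquot_scale.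
Proof. by move=> v; rewrite -[v]reprK !piE scale1r. Qed.

Lemma lquot_scaleDr : right_distributive lquot_scale +%R.
Proof. by move=> a u v; rewrite -[u]reprK -[v]reprK !piE scalerDr. Qed.

Lemma lquot_scaleDl v : {morph lquot_scale^~ v : a b / a + b}.
Proof. by move=> a b; rewrite -[v]reprK !piE scalerDl. Qed.

HB.instance Definition _ := GRing.Zmodule_isLmodule.Build R lquot
  lquot_scaleA lquot_scale1 lquot_scaleDr lquot_scaleDl.

End QuotientSpace.

(* Dimensions are cardinals, possibly infinite. Every vector space has a      *)
(* basis and all its bases are equipotent, so dim_le and dim_eq compare one   *)
(* basis of V with one basis of W.                                            *)

Section Dimension.
Variables (R : fieldType) (V : lmodType R).

Definition linearly_independent (B : set V) : Prop :=
  forall (s : seq V) (c : V -> R), uniq s -> (forall v, v \in s -> B v) ->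
    \sum_(v <- s) c v *: v = 0 -> forall v, v \in s -> c v = 0.

Definition spanning (B : set V) : Prop :=
  forall x : V, exists (s : seq V) (c : V -> R),
    (forall v, v \in s -> B v) /\ x = \sum_(v <- s) c v *: v.

Definition hamel_basis (B : set V) : Prop :=
  linearly_independent B /\ spanning B.

End Dimension.

Definition dim_le (R : fieldType) (V W : lmodType R) : Prop :=
  exists (B : set V) (C : set W),
    [/\ hamel_basis B, hamel_basis C & (B #<= C)%card].

Definition dim_eq (R : fieldType) (V W : lmodType R) : Prop :=
  exists (B : set V) (C : set W),
    [/\ hamel_basis B, hamel_basis C & (B #= C)%card].

Definition conj_closed (G : groupType) (S : {pred G}) : Prop :=
  forall g x, x \in S -> (g * x * g^-1)%g \in S.

HB.mixin Record isConjClosed (G : groupType) (S : {pred G}) := {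
  gpred_conj : conj_closed S
}.

#[short(type="normalSubgroup")]
HB.structure Definition NormalSubgroup (G : groupType) :=
  {S of GroupClosed G S & isConjClosed G S}.

Section SubgroupType.
Variables (G : groupType) (N : groupClosed G).

Definition subgroup : Type := {x : G | x \in N}.

HB.instance Definition _ := [isSub of subgroup for @sval _ _].
HB.instance Definition _ := [Choice of subgroup by <:].

Lemma subgroup_closed : group_closed N.
Proof. by split=> [|x y xN yN]; [exact: gpred1 | exact: gpredF]. Qed.

HB.instance Definition _ :=
  SubChoice_isSubGroup.Build G _ subgroup subgroup_closed.

End SubgroupType.

Section NormalTheory.
Local Open Scope group_scope.
Variables (G : groupType) (N : normalSubgroup G).

Definition nconj (g : G) (x : subgroup N) : subgroup N :=
  Sub (g * val x * g^-1) (gpred_conj g _ (valP x)).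

Definition coset_equiv (x y : G) : bool := x / y \in N.

Lemma coset_equiv_is_equiv : equiv_class_of coset_equiv.
Proof.
split=> [x|x y|y x z]; rewrite /coset_equiv.
- by rewrite mulgV gpred1.
- by rewrite gpredFC.
- by move=> xy yz; rewrite -[x](mulgVK y) -mulgA gpredM.
Qed.

Canonical coset_equiv_equiv := EquivRelPack coset_equiv_is_equiv.
Canonical coset_equiv_encModRel := defaultEncModRel coset_equiv.

Definition quotg := {eq_quot coset_equiv}.

HB.instance Definition _ : EqQuotient G coset_equiv quotg :=
  EqQuotient.on quotg.
HB.instance Definition _ := Choice.on quotg.

Lemma coset_equivE x y : (x / y \in N) = (x == y %[mod quotg]).
Proof. by rewrite piE. Qed.

Definition quotg_one : quotg := lift_cst quotg 1.
Definition quotg_mul := lift_op2 quotg *%g.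
Definition quotg_inv := lift_op1 quotg (fun x => x^-1).

Canonical pi_quotg_one_morph := PiConst quotg_one.

Lemma pi_mulg : {morph \pi_quotg : x y / x * y >-> quotg_mul x y}.
Proof.
move=> x y /=; unlock quotg_mul; apply/eqP; rewrite piE /coset_equiv /=.
set x' := repr _; set y' := repr _.
have hx : x / x' \in N by rewrite coset_equivE reprK.
have hy : y / y' \in N by rewrite coset_equivE reprK.
rewrite (_ : _ / _ = (x * (y / y') * x^-1) * (x / x')); last first.
  by rewrite invgM !mulgA mulgVK.
by rewrite gpredM // gpred_conj.
Qed.
Canonical pi_mulg_morph := PiMorph2 pi_mulg.

Lemma pi_invg : {morph \pi_quotg : x / x^-1 >-> quotg_inv x}.
Proof.
move=> x; unlock quotg_inv; apply/eqP; rewrite piE /coset_equiv /=.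
set x' := repr _.
have hx : x' / x \in N by rewrite coset_equivE reprK.
by have := gpred_conj x^-1 _ hx; rewrite !invgK !mulgA mulgVK.
Qed.
Canonical pi_invg_morph := PiMorph1 pi_invg.

Lemma quotg_mulA : associative quotg_mul.
Proof.
by move=> x y z; rewrite -[x]reprK -[y]reprK -[z]reprK !piE mulgA.
Qed.

Lemma quotg_mul1 : left_id quotg_one quotg_mul.
Proof. by move=> x; rewrite -[x]reprK !piE mul1g. Qed.

Lemma quotg_mulr1 : right_id quotg_one quotg_mul.
Proof. by move=> x; rewrite -[x]reprK !piE mulg1. Qed.

Lemma quotg_mulV : left_inverse quotg_one quotg_inv quotg_mul.
Proof. by move=> x; rewrite -[x]reprK !piE mulVg. Qed.

Lemma quotg_mulrV : right_inverse quotg_one quotg_inv quotg_mul.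
Proof. by move=> x; rewrite -[x]reprK !piE mulgV. Qed.

HB.instance Definition _ := isGroup.Build quotg
  quotg_mulA quotg_mul1 quotg_mulr1 quotg_mulV quotg_mulrV.

Lemma pi_quotg1 : \pi_quotg 1 = 1.
Proof. exact: lock. Qed.

Lemma pi_quotgM : {morph \pi_quotg : x y / x * y}.
Proof. exact: pi_mulg. Qed.

Lemma pi_quotg_eq1 (x : G) : (\pi_quotg x == 1) = (x \in N).
Proof. by rewrite -pi_quotg1 -coset_equivE invg1 mulg1. Qed.

End NormalTheory.

Definition zexpg (G : groupType) (x : G) (n : int) : G :=
  match n with Posz m => (x ^+ m)%g | Negz m => (x ^- m.+1)%g end.

Section Quasimorphisms.
Variables (R : realType) (G : groupType).

Definition quasimorphism (f : G -> R) : Prop :=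
  exists D : R, forall x y : G, `|f (x * y)%g - f x - f y| <= D.

Definition homogeneous (f : G -> R) : Prop :=
  forall (x : G) (n : int), f (zexpg x n) = n%:~R * f x.

(* R^o is R as a vector space over itself, which makes G -> R^o an lmodType.  *)
Definition hqm_pred : {pred (G -> R^o)} :=
  fun f => `[< quasimorphism f /\ homogeneous f >].

Lemma hqm_pred_closed : GRing.submod_closed hqm_pred.
Proof.
split=> [|a f g /asboolP[[D hD] hf] /asboolP[[E hE] hg]]; apply/asboolP; split.
- by exists 0 => x y; rewrite /= !subr0 normr0.
- by move=> x n; rewrite mulr0.
- exists (`|a| * D + E) => x y.
  rewrite (_ : _ - _ = a * (f (x * y)%g - f x - f y)
                        + (g (x * y)%g - g x - g y)); last first.
    by rewrite !fctE /= /GRing.scale /=; ring.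
  by rewrite (le_trans (ler_normD _ _)) ?lerD ?normrM ?ler_wpM2l.
- by move=> x n; rewrite !fctE /= hf hg /GRing.scale /= mulrDr mulrCA.
Qed.

HB.instance Definition _ := GRing.isSubmodClosed.Build R (G -> R^o) hqm_pred
  (GRing.submod_closed_semi hqm_pred_closed).

(* Q(G) *)
Definition hqm : Type := {f : G -> R^o | f \in hqm_pred}.

HB.instance Definition _ := [isSub of hqm for @sval _ _].
HB.instance Definition _ := [Choice of hqm by <:].
HB.instance Definition _ := [SubChoice_isSubLmodule of hqm by <:].

End Quasimorphisms.

Section InvariantQuasimorphisms.
Variables (R : realType) (G : groupType) (N : normalSubgroup G).

Definition inv_hqm_pred : {pred (subgroup N -> R^o)} :=
  fun f => `[< f \in @hqm_pred R (subgroup N) /\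
               forall (g : G) (x : subgroup N), f (nconj g x) = f x >].

Lemma inv_hqm_pred_closed : GRing.submod_closed inv_hqm_pred.
Proof.
split=> [|a f g /asboolP[fQ hf] /asboolP[gQ hg]]; apply/asboolP; split=> //.
- exact: rpred0.
- by rewrite rpredD ?rpredZ.
- by move=> x y; rewrite !fctE /= hf hg.
Qed.

HB.instance Definition _ :=
  GRing.isSubmodClosed.Build R (subgroup N -> R^o) inv_hqm_pred
    (GRing.submod_closed_semi inv_hqm_pred_closed).

(* Q(N)^G *)
Definition inv_hqm : Type := {f : subgroup N -> R^o | f \in inv_hqm_pred}.

HB.instance Definition _ := [isSub of inv_hqm for @sval _ _].
HB.instance Definition _ := [Choice of inv_hqm by <:].
HB.instance Definition _ := [SubChoice_isSubLmodule of inv_hqm by <:].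

(* i^*Q(G) as a subspace of Q(N)^G. *)
Definition extendable : {pred inv_hqm} :=
  fun f => `[< exists F : hqm R G, forall x : subgroup N,
                 val f x = val F (val x) >].

Lemma extendable_closed : GRing.submod_closed extendable.
Proof.
split=> [|a f g /asboolP[F hF] /asboolP[F' hF']]; apply/asboolP.
  by exists 0.
exists (a *: F + F') => x; rewrite [val (_ + _)]linearP [in RHS]linearP.
by rewrite -[LHS]/(a * val f x + val g x) hF hF'.
Qed.

HB.instance Definition _ := GRing.isSubmodClosed.Build R inv_hqm extendable
  (GRing.submod_closed_semi extendable_closed).

(* Q(N)^G / i^*Q(G) *)
Definition nonextendable_space : lmodType R := lquot extendable.

End InvariantQuasimorphisms.

Section Cohomology.
Variables (R : realType) (H : groupType).

Definition cochain (n : nat) : Type := ('I_n -> H) -> R^o.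

HB.instance Definition _ n := GRing.Lmodule.on (cochain n).

(* With g = (g_1, .., g_{n+1}): face 0 g = (g_2, .., g_{n+1}),               *)
(* face i g = (g_1, .., g_i g_{i+1}, .., g_{n+1}) for 1 <= i <= n, and       *)
(* face n.+1 g = (g_1, .., g_n). Indices j below start at 0.                 *)
Definition face (n : nat) (i : 'I_n.+2) (g : 'I_n.+1 -> H) : 'I_n -> H :=
  fun j =>
    if (j.+1 < i)%N then g (widen_ord (leqnSn n) j)
    else if j.+1 == i :> nat then (g (widen_ord (leqnSn n) j) * g (lift ord0 j))%g
    else g (lift ord0 j).

Definition coboundary (n : nat) (f : cochain n) : cochain n.+1 :=
  fun g => \sum_(i < n.+2) (-1) ^+ i * f (face i g).

Lemma coboundary_is_linear n : linear (@coboundary n).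
Proof.
move=> a f h; apply/funext => g; rewrite /coboundary !fctE /=.
rewrite /GRing.scale /= mulr_sumr -big_split /=; apply: eq_bigr => i _.
by rewrite mulrDr mulrCA.
Qed.

HB.instance Definition _ n :=
  GRing.isLinear.Build R (cochain n) (cochain n.+1) _ (@coboundary n)
    (@coboundary_is_linear n).

Section Subcomplex.
Variable A : forall n, submodClosed (cochain n).

Definition cocycle_pred (n : nat) : {pred cochain n} :=
  fun f => (f \in A n) && (coboundary f == 0).

Lemma cocycle_pred_closed n : GRing.submod_closed (@cocycle_pred n).
Proof.
split=> [|a f g /andP[fA /eqP hf] /andP[gA /eqP hg]]; apply/andP; split.
- exact: rpred0.
- by rewrite linear0.
- by rewrite rpredD ?rpredZ.
- by rewrite linearP /= hf hg scaler0 addr0.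
Qed.

HB.instance Definition _ n :=
  GRing.isSubmodClosed.Build R (cochain n) (@cocycle_pred n)
    (GRing.submod_closed_semi (@cocycle_pred_closed n)).

Definition cocycle (n : nat) : Type := {f : cochain n | f \in @cocycle_pred n}.

HB.instance Definition _ n := [isSub of cocycle n for @sval _ _].
HB.instance Definition _ n := [Choice of cocycle n by <:].
HB.instance Definition _ n := [SubChoice_isSubLmodule of cocycle n by <:].

Definition coboundary_pred (n : nat) : {pred cocycle n} :=
  match n with
  | 0 => fun z => z == 0
  | m.+1 => fun z => `[< exists2 h, h \in A m & val z = coboundary h >]
  end.

Lemma coboundary_pred_closed n : GRing.submod_closed (@coboundary_pred n).
Proof.
case: n => [|n]; split.
- by rewrite unfold_in /=.
- move=> a u v; rewrite !unfold_in /= => /eqP-> /eqP->.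
  by rewrite scaler0 addr0.
- by apply/asboolP; exists 0; [exact: rpred0 | rewrite !linear0].
- move=> a u v /asboolP[h hA hu] /asboolP[k kA kv]; apply/asboolP.
  exists (a *: h + k); first by rewrite rpredD ?rpredZ.
  transitivity (a *: val u + val v); first exact: linearP.
  by rewrite hu kv [RHS]linearP.
Qed.

HB.instance Definition _ n :=
  GRing.isSubmodClosed.Build R (cocycle n) (@coboundary_pred n)
    (GRing.submod_closed_semi (@coboundary_pred_closed n)).

Definition subcomplex_cohomology (n : nat) : lmodType R :=
  lquot (@coboundary_pred n).

End Subcomplex.

Definition all_cochains (n : nat) : {pred cochain n} := predT.

Lemma all_cochains_closed n : GRing.submod_closed (@all_cochains n).
Proof. by []. Qed.

HB.instance Definition _ n :=
  GRing.isSubmodClosed.Build R (cochain n) (@all_cochains n)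
    (GRing.submod_closed_semi (@all_cochains_closed n)).

Definition bounded_cochains (n : nat) : {pred cochain n} :=
  fun f => `[< exists D : R, forall g, `|f g| <= D >].

Lemma bounded_cochains_closed n : GRing.submod_closed (@bounded_cochains n).
Proof.
split=> [|a f h /asboolP[D hD] /asboolP[E hE]]; apply/asboolP.
  by exists 0 => g; rewrite normr0.
exists (`|a| * D + E) => g; rewrite !fctE /=.
by rewrite (le_trans (ler_normD _ _)) ?lerD ?normrM ?ler_wpM2l.
Qed.

HB.instance Definition _ n :=
  GRing.isSubmodClosed.Build R (cochain n) (@bounded_cochains n)
    (GRing.submod_closed_semi (@bounded_cochains_closed n)).

Definition cohomology (n : nat) : lmodType R :=
  subcomplex_cohomology (fun n => @all_cochains n) n.

Definition bounded_cohomology (n : nat) : lmodType R :=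
  subcomplex_cohomology (fun n => @bounded_cochains n) n.

Definition boundedly_acyclic (k : nat) : Prop :=
  forall j : nat, (1 <= j <= k)%N -> forall c : bounded_cohomology j, c = 0.

End Cohomology.

Section WordMetric.
Variables (G : groupType) (S : seq G).

Definition has_word (g : G) (n : nat) : Prop :=
  exists w : seq G,
    [/\ all (fun s => (s \in S) || (s^-1%g \in S)) w, size w = n
      & (\prod_(s <- w) s)%g = g].

Definition generates : Prop := forall g : G, exists n, has_word g n.

Hypothesis genS : generates.

Lemma word_length_subproof (g : G) : exists n, `[< has_word g n >].
Proof. by have [n gn] := genS g; exists n; apply/asboolP. Qed.

Definition word_length (g : G) : nat := ex_minn (word_length_subproof g).

Definition word_dist (x y : G) : nat := word_length (x^-1 * y)%g.

End WordMetric.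

Section Hyperbolicity.
Variable R : realType.

Definition gromov_product (T : Type) (d : T -> T -> R) (w x y : T) : R :=
  (d w x + d w y - d x y) / 2.

Definition hyperbolic_metric (T : Type) (d : T -> T -> R) : Prop :=
  exists delta : R, forall w x y z : T,
    Num.min (gromov_product d w x y) (gromov_product d w y z) - delta
      <= gromov_product d w x z.

(* Gromov's four-point condition for the word metric of some finite          *)
(* generating set.                                                            *)
Definition hyperbolic_group (G : groupType) : Prop :=
  exists (S : seq G) (genS : generates S),
    hyperbolic_metric (fun x y => (word_dist genS x y)%:R).

End Hyperbolicity.

(* Main.v *)
(* Call f in Q(N)^G and a real 2-cocycle c on Gamma = G/N related if there is *)
(* F : G -> R such that F|_N - f and dF - pi^*c are bounded. Since            *)
(* H^3_b(Gamma) = 0, every f is related to some c: take F(n s) = f(n) for s   *)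
(* in a transversal; then dF is at bounded distance from the pullback of a    *)
(* cochain with bounded coboundary, and a bounded correction turns the latter *)
(* into a cocycle. Since H^2_b(Gamma) = 0, f extends to G if and only if c is *)
(* a coboundary. So the relation induces an injective linear map              *)
(* Q(N)^G / i^*Q(G) -> H^2(Gamma).                                            *)
(*                                                                            *)
(* It is onto as soon as every pi^*c is cohomologous to a bounded cocycle;    *)
(* for hyperbolic G every real 2-cocycle c on G is. Lift words to the central *)
(* extension of G by R with cocycle c, and let the holonomy of a word be its  *)
(* real coordinate. By Dehn's algorithm the holonomy of a loop grows at most  *)
(* linearly with its length, say with slope K, so that                        *)
(*   phi(g) = sup { holonomy w - (K + 1) |w| : w represents g }               *)
(* is finite and its near-optimal words are quasigeodesics. By the Morse      *)
(* lemma phi is additive along geodesics up to a bounded error. Cutting the   *)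
(* triangle 1, g, gh at a centre, only the contribution to d phi of the       *)
(* segment from the centre to g, travelled in both directions, survives. It   *)
(* is the same for the inverse triangle, hence disappears when phi is         *)
(* antisymmetrized, and what remains has coboundary at bounded distance       *)
(* from c.                                                                    *)

(* The relation just described is [transgression]. Every f has a partner by [transgression_total]
   (H^3_b = 0); the two halves of the extension criterion are [transgression_coboundary] (H^2_b = 0)
   and [transgression_extendable]. [relation_linear_map] turns such a relation into an injective
   linear map of quotients, and bases obtained from Zorn's lemma are carried along it ([dim_le_inj],
   [dim_eq_bij]), so infinite dimensions need no separate care. Bounded errors are removed in two
   ways: on the quotient group by bounded acyclicity, and on G and N by homogenization, since
   homogeneous functions at bounded distance agree ([homogeneous_unique]). Surjectivity rests on
   [hyperbolic_cocycle_bounded], whose geometric inputs are [linear_isoperimetric], [morse] and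
   [triangle_centre]. *)
From HB Require Import structures.
Require Import Defs.
From mathcomp Require Import all_boot all_order all_algebra.
From mathcomp Require Import all_classical reals.
From mathcomp Require Import zify ring lra.

Set Implicit Arguments.
Unset Strict Implicit.
Unset Printing Implicit Defensive.

Import Order.TTheory GRing.Theory Num.Theory.

Local Open Scope ring_scope.
Local Open Scope quotient_scope.

(** * Hamel bases and quotient spaces *)

Section HamelBases.
Local Open Scope classical_set_scope.
Variables (R : fieldType) (V : lmodType R).
Implicit Types (B : set V) (s : seq V) (c : V -> R).

Lemma linearly_independent_add B x :
  linearly_independent B ->
  ~ (exists s c, (forall v, v \in s -> B v) /\ x = \sum_(v <- s) c v *: v) ->
  linearly_independent (x |` B).
Proof.
move=> indB xB s c us sB s0.
have [xs|xs] := boolP (x \in s); last first.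
  apply: indB => // v vs; case: (sB v vs) => // vx.
  by rewrite vx in vs; rewrite vs in xs.
have remB v : v \in rem x s -> B v.
  rewrite mem_rem_uniq // inE => /andP[/eqP vx vs].
  by case: (sB v vs) => // /vx.
move: s0; rewrite (perm_big _ (perm_to_rem xs)) big_cons /= => s0.
have cx : c x = 0.
  apply: contra_notP xB => /eqP cx.
  exists (rem x s), (fun v => - (c x)^-1 * c v); split=> //.
  under eq_bigr do rewrite -scalerA.
  rewrite -scaler_sumr; move/eqP: s0; rewrite addrC addr_eq0 => /eqP ->.
  by rewrite scalerN scaleNr opprK scalerA mulVf ?scale1r.
rewrite cx scale0r add0r in s0.
move=> v vs; have [->//|vx] := eqVneq v x.
apply: (indB _ _ (rem_uniq x us) remB s0).
by rewrite mem_rem_uniq // inE vx.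
Qed.

Lemma hamel_basis_extend B0 : linearly_independent B0 ->
  exists B, hamel_basis B /\ B0 `<=` B.
Proof.
move=> ind0.
(* Zorn is applied to the sets X to be added to B0, not to the supersets of B0: the empty chain then
   has the admissible union [set0]. For a nonempty chain, a finite family already lies in B0
   together with one member. *)
pose P : set (set V) := [set X | linearly_independent (B0 `|` X)].
have [|X [indX Xmax]] := @Zorn_bigcup V P.
  move=> F FP totF; have [[X0 FX0]|F0] := pselect (exists X, F X); last first.
    rewrite (_ : \bigcup_(X in F) X = set0); first by rewrite /P /= setU0.
    by apply/seteqP; split=> // x [X FX _]; apply: F0; exists X.
  move=> s c us sB s0.
  suff [X FX sX] : exists2 X, F X & forall v, v \in s -> (B0 `|` X) v.
    exact: (FP X FX s c us sX s0).
  have {us s0} : forall v, v \in s -> (B0 `|` \bigcup_(X in F) X) v by [].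
  elim: s {sB} => [_|a s IHs asB]; first by exists X0.
  have [v vs|X FX sX] := IHs; first by apply: asB; rewrite inE vs orbT.
  have [aB|[Y FY aY]] := asB a (mem_head _ _).
    exists X => // v; rewrite inE => /orP[/eqP->|]; last exact: sX.
    by left.
  have [XY|YX] := totF X Y FX FY.
    exists Y => // v; rewrite inE => /orP[/eqP->|/sX[]]; [by right|by left|].
    by move=> /XY; right.
  exists X => // v; rewrite inE => /orP[/eqP->|]; last exact: sX.
  by right; apply: YX.
exists (B0 `|` X); split; last by move=> x; left.
split=> // x; apply: contrapT => xB.
have indx := linearly_independent_add indX xB.
apply: (Xmax (x |` X)); last by rewrite /P /= setUCA.
rewrite properEneq; split; last by move=> y; right.
apply/eqP=> XxX; apply: xB; exists [:: x], (fun=> 1); split.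
  by move=> v; rewrite inE => /eqP->; right; rewrite XxX; left.
by rewrite big_seq1 scale1r.
Qed.

Lemma hamel_basis_exists : exists B : set V, hamel_basis B.
Proof.
have [|B [hB _]] := @hamel_basis_extend set0; last by exists B.
move=> s c _ sB _ v vs; exact: False_ind (sB v vs).
Qed.

End HamelBases.

Section DimensionComparison.
Local Open Scope classical_set_scope.
Variables (R : fieldType) (V W : lmodType R) (f : {linear V -> W}).
Hypothesis f_inj : injective f.

Lemma linearly_independent_image (B : set V) :
  linearly_independent B -> linearly_independent (f @` B).
Proof.
move=> indB s c us sB s0.
have /choice[g gP] : forall w, exists v, w \in s -> B v /\ f v = w.
  move=> w; have [ws|] := boolP (w \in s); last by exists 0.
  by have [v Bv vw] := sB w ws; exists v.
have fgs : map f (map g s) = s.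
  by rewrite -map_comp map_id_in // => w /gP[].
have ugs : uniq (map g s) by rewrite -(map_inj_uniq f_inj) fgs.
move=> w ws; have [_ <-] := gP w ws.
apply: (indB (map g s) (c \o f) ugs); last exact: map_f.
  by move=> _ /mapP[v /gP[Bv _] ->].
apply: f_inj; rewrite linear0 linear_sum -[RHS]s0 -[in RHS]fgs [RHS]big_map.
by apply: eq_bigr => v _; rewrite linearZ.
Qed.

Lemma dim_le_inj : dim_le V W.
Proof.
have [B hB] := hamel_basis_exists V.
have [C [hC BC]] := hamel_basis_extend (linearly_independent_image hB.1).
have fB : (f @` B #= B)%card by apply: inj_card_eq => ? ? _ _ /f_inj.
by exists B, C; split=> //; rewrite -(card_le_eql fB) subset_card_le.
Qed.

Lemma dim_eq_bij : (forall w, exists v, f v = w) -> dim_eq V W.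
Proof.
move=> f_surj; have [B hB] := hamel_basis_exists V.
exists B, (f @` B); split=> //; last first.
  by apply: card_esym; apply: inj_card_eq => ? ? _ _ /f_inj.
split=> [|w]; first exact: linearly_independent_image hB.1.
have /choice[g fK] := f_surj.
have gK : cancel f g by move=> v; apply: f_inj; rewrite fK.
have [s [c [sB wE]]] := hB.2 (g w).
exists (map f s), (c \o g); split.
  by move=> _ /mapP[v /sB Bv ->]; exists v.
rewrite -[LHS]fK wE linear_sum big_map.
by apply: eq_bigr => v _ /=; rewrite gK linearZ.
Qed.

End DimensionComparison.

Section LinearQuotient.
Variables (R : pzRingType) (V : lmodType R) (U : submodClosed V).

Lemma pi_lquot_eq (u v : V) :
  (\pi_(lquot U) u == \pi_(lquot U) v) = (u - v \in U).
Proof. by rewrite -(Quotient.idealrBE (zmod_of U)). Qed.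

Lemma pi_lquot_eq0 (v : V) : (\pi_(lquot U) v == 0) = (v \in U).
Proof. by rewrite -(pi_zeror (s := lquot U)) pi_lquot_eq subr0. Qed.

Lemma pi_lquot_linear : linear (\pi_(lquot U)).
Proof. by move=> a u v; rewrite !piE. Qed.

End LinearQuotient.

Section LinearRelation.
Variables (R : fieldType) (V W : lmodType R).
Variables (U : submodClosed V) (X : submodClosed W) (rel : V -> W -> Prop).
Hypothesis rel_lin : forall a v w v' w',
  rel v w -> rel v' w' -> rel (a *: v + v') (a *: w + w').
Hypothesis rel_total : forall v, exists w, rel v w.
Hypothesis rel_sub : forall v w, rel v w -> (v \in U) = (w \in X).

(** Both directions of [rel_sub] are used on differences: from U to X it makes the class of w
    independent of choices, from X to U it gives injectivity. *)
Lemma relation_linear_map : exists f : {linear lquot U -> lquot X},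
  injective f /\ forall v w, rel v w -> f (\pi_(lquot U) v) = \pi_(lquot X) w.
Proof.
have relB v w v' w' : rel v w -> rel v' w' -> rel (v - v') (w - w').
  by move=> vw /(rel_lin (-1))/(_ vw); rewrite !scaleN1r ![- _ + _]addrC.
have /choice[g gP] := rel_total.
pose f (q : lquot U) : lquot X := \pi_(lquot X) (g (repr q)).
have fE v w : rel v w -> f (\pi_(lquot U) v) = \pi_(lquot X) w.
  move=> vw; apply/eqP; rewrite pi_lquot_eq -(rel_sub (relB _ _ _ _ (gP _) vw)).
  by rewrite -pi_lquot_eq reprK.
have f_lin : linear f.
  move=> a p q; rewrite -[p]reprK -[q]reprK -pi_lquot_linear.
  rewrite (fE _ _ (rel_lin a (gP _) (gP _))) !(fE _ _ (gP _)).
  by rewrite pi_lquot_linear.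
pose fL := GRing.isLinear.Build R (lquot U) (lquot X) _ f f_lin.
pose fH : {linear lquot U -> lquot X} := HB.pack f fL.
exists fH; split=> // p q /eqP.
rewrite -[p]reprK -[q]reprK /= !(fE _ _ (gP _)) pi_lquot_eq.
by rewrite -(rel_sub (relB _ _ _ _ (gP _) (gP _))) -pi_lquot_eq => /eqP.
Qed.

Lemma relation_dim_le : dim_le (lquot U) (lquot X).
Proof. by have [f [/dim_le_inj]] := relation_linear_map. Qed.

Lemma relation_dim_eq :
  (forall w, exists v, rel v w) -> dim_eq (lquot U) (lquot X).
Proof.
move=> surj; have [f [finj fE]] := relation_linear_map.
apply: (dim_eq_bij finj) => q; have [v vq] := surj (repr q).
by exists (\pi_(lquot U) v); rewrite (fE _ _ vq) reprK.
Qed.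

End LinearRelation.

(** * Cochains of low degree *)

Section LowDegreeCochains.
Variables (R : realType) (H : groupType).
Local Notation coch := (cochain R H).

(** Tuples come from sequences so that the faces of an explicit tuple reduce by computation; the
    default 1 is never read when s has length n. *)
Definition vec (n : nat) (s : seq H) : 'I_n -> H := fun i => nth 1%g s i.

Lemma vec2P (g : 'I_2 -> H) : exists x y, g = vec [:: x; y].
Proof.
exists (g ord0), (g ord_max); apply/funext => -[[|[|//]] i2];
  by rewrite /vec /=; congr g; apply: val_inj.
Qed.

Lemma coboundary1E (h : coch 1) x y : coboundary h (vec [:: x; y]) =
  h (vec [:: y]) - h (vec [:: (x * y)%g]) + h (vec [:: x]).
Proof.
have E : forall i : 'I_3, face i (@vec 2 [:: x; y]) =
    vec (nth [::] [:: [:: y]; [:: (x * y)%g]; [:: x]] i).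
  move=> [[|[|[|//]]] i3]; apply/funext => -[[|//] j]; by [].
rewrite /coboundary !big_ord_recl big_ord0 !E /= /bump /=.
have alt (a b c : R) : (-1) ^+ 0 * a + ((-1) ^+ (1 + 0) * b
    + ((-1) ^+ (1 + (1 + 0)) * c + 0)) = a - b + c by ring.
exact: alt.
Qed.

Lemma coboundary2E (h : coch 2) x y z : coboundary h (vec [:: x; y; z]) =
  h (vec [:: y; z]) - h (vec [:: (x * y)%g; z]) + h (vec [:: x; (y * z)%g])
    - h (vec [:: x; y]).
Proof.
have E : forall i : 'I_4, face i (@vec 3 [:: x; y; z]) =
    vec (nth [::] [:: [:: y; z]; [:: (x * y)%g; z]; [:: x; (y * z)%g];
      [:: x; y]] i).
  by move=> [[|[|[|[|//]]]] i4]; apply/funext => -[[|[|//]] j].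
rewrite /coboundary !big_ord_recl big_ord0 !E /= /bump /=.
have alt (a b c d : R) : (-1) ^+ 0 * a + ((-1) ^+ (1 + 0) * b
    + ((-1) ^+ (1 + (1 + 0)) * c + ((-1) ^+ (1 + (1 + (1 + 0))) * d + 0)))
    = a - b + c - d by ring.
exact: alt.
Qed.

Lemma coboundary3E (h : coch 3) x y z t : coboundary h (vec [:: x; y; z; t]) =
  h (vec [:: y; z; t]) - h (vec [:: (x * y)%g; z; t])
  + h (vec [:: x; (y * z)%g; t]) - h (vec [:: x; y; (z * t)%g])
  + h (vec [:: x; y; z]).
Proof.
have E : forall i : 'I_5, face i (@vec 4 [:: x; y; z; t]) =
    vec (nth [::] [:: [:: y; z; t]; [:: (x * y)%g; z; t];
      [:: x; (y * z)%g; t]; [:: x; y; (z * t)%g]; [:: x; y; z]] i).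
  by move=> [[|[|[|[|[|//]]]]] i5]; apply/funext => -[[|[|[|//]]] j].
rewrite /coboundary !big_ord_recl big_ord0 !E /= /bump /=.
have alt (a b c d e : R) : (-1) ^+ 0 * a + ((-1) ^+ (1 + 0) * b
    + ((-1) ^+ (1 + (1 + 0)) * c + ((-1) ^+ (1 + (1 + (1 + 0))) * d
    + ((-1) ^+ (1 + (1 + (1 + (1 + 0)))) * e + 0)))) = a - b + c - d + e.
  by ring.
exact: alt.
Qed.

Lemma vec3P (g : 'I_3 -> H) : exists x y z, g = vec [:: x; y; z].
Proof.
exists (g ord0), (g (inord 1)), (g ord_max).
by apply/funext => -[[|[|[|//]]] i3]; rewrite /vec /=; congr g;
  apply: val_inj; rewrite /= ?inordK.
Qed.

Lemma vec4P (g : 'I_4 -> H) : exists x y z t, g = vec [:: x; y; z; t].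
Proof.
exists (g ord0), (g (inord 1)), (g (inord 2)), (g ord_max).
by apply/funext => -[[|[|[|[|//]]]] i4]; rewrite /vec /=; congr g;
  apply: val_inj; rewrite /= ?inordK.
Qed.

Lemma coboundaryK2 (h : coch 2) : coboundary (coboundary h) = 0.
Proof.
apply/funext => g; have [x [y [z [t ->]]]] := vec4P g.
rewrite coboundary3E !coboundary2E !mulgA.
by apply: (_ : _ = 0 :> R); ring.
Qed.

Definition cocycle2 (c : H -> H -> R) : Prop :=
  forall x y z, c y z + c x (y * z)%g = c (x * y)%g z + c x y.

Definition curry2 (f : coch 2) (x y : H) : R := f (vec [:: x; y]).

Definition uncurry2 (c : H -> H -> R) : coch 2 :=
  fun g => c (g ord0) (g ord_max).

Lemma cocycle2P (f : coch 2) : coboundary f = 0 <-> cocycle2 (curry2 f).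
Proof.
split=> [f0 x y z|fc].
  have : coboundary f (vec [:: x; y; z]) = 0 :> R by rewrite f0.
  by rewrite coboundary2E /curry2; lra.
apply/funext => g; have [x [y [z ->]]] := vec3P g; rewrite coboundary2E.
by apply: (_ : _ = 0 :> R); have := fc x y z; rewrite /curry2; lra.
Qed.

Definition uncurry1 (p : H -> R) : coch 1 := fun g => p (g ord0).

Lemma coboundary_curry (f : coch 2) (p : H -> R) :
  (forall x y, curry2 f x y = p x + p y - p (x * y)%g) ->
  f = coboundary (uncurry1 p).
Proof.
move=> fp; apply/funext => g; have [x [y ->]] := vec2P g.
rewrite coboundary1E -/(curry2 f x y) fp /uncurry1 /vec /=.
by apply: (_ : _ = _ :> R); ring.
Qed.

Lemma curry_coboundary (h : coch 1) x y : curry2 (coboundary h) x y =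
  h (vec [:: x]) + h (vec [:: y]) - h (vec [:: (x * y)%g]).
Proof. by rewrite /curry2 coboundary1E; apply: (_ : _ = _ :> R); ring. Qed.

Lemma bounded_cocycle_exact (k j : nat) (z : coch j.+1) :
  boundedly_acyclic R H k -> (j < k)%N ->
  (exists D, forall g, `|z g| <= D) -> coboundary z = 0 ->
  exists h : coch j, (exists D, forall g, `|h g| <= D) /\ z = coboundary h.
Proof.
move=> acy jk /asboolP zb z0.
have zP : z \in @cocycle_pred R H (fun n => @bounded_cochains R H n) j.+1.
  by apply/andP; split; [exact: zb | exact/eqP].
have /eqP := acy j.+1 jk (\pi_(bounded_cohomology R H j.+1) (exist _ z zP)).
rewrite pi_lquot_eq0 => /asboolP[h /asboolP hb zh].
by exists h.
Qed.

Hypothesis acy : boundedly_acyclic R H 3.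

Lemma bounded_cocycle2_exact (c : H -> H -> R) : cocycle2 c ->
  (exists D, forall x y, `|c x y| <= D) ->
  exists p : H -> R, (exists D, forall x, `|p x| <= D) /\
    forall x y, c x y = p x + p y - p (x * y)%g.
Proof.
move=> cC [D cD].
have [|/=|h [[E hE] ch]] := bounded_cocycle_exact (z := uncurry2 c) acy isT.
- by exists D => g; exact: cD.
- exact/cocycle2P.
exists (fun x => h (vec [:: x])); split; first by exists E => x; exact: hE.
by move=> x y; rewrite -curry_coboundary -ch.
Qed.

(** This is where H^3_b = 0 enters: the coboundary of a is a bounded 3-cocycle, hence the coboundary
    of some bounded b. *)
Lemma bounded_coboundary2_correct (a : H -> H -> R) :
  (exists D, forall x y z,
    `|a y z - a (x * y)%g z + a x (y * z)%g - a x y| <= D) ->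
  exists b : H -> H -> R, (exists D, forall x y, `|b x y| <= D) /\
    cocycle2 (fun x y => a x y - b x y).
Proof.
move=> [D aD].
have [||h [[E hE] ah]] :=
  bounded_cocycle_exact (z := coboundary (uncurry2 a)) acy isT.
- exists D => g; have [x [y [z ->]]] := vec3P g; rewrite coboundary2E.
  exact: aD.
- exact: coboundaryK2.
exists (curry2 h); split; first by exists E => x y; exact: hE.
move=> x y z.
have : coboundary (uncurry2 a) (vec [:: x; y; z])
    = coboundary h (vec [:: x; y; z]) :> R by rewrite ah.
by rewrite !coboundary2E /uncurry2 /vec /curry2 /=; lra.
Qed.

End LowDegreeCochains.

(** * Homogenization of quasimorphisms *)

Section Homogenization.
Variables (R : realType) (G : groupType).
Implicit Types (f : G -> R) (x y : G) (C D : R).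

Lemma eq0_of_bounded_multiples (a C : R) :
  (forall n : nat, n%:R * `|a| <= C) -> a = 0.
Proof.
move=> aC; apply/eqP; rewrite -normr_eq0; apply/contraT => a0.
have {}a0 : 0 < `|a| by rewrite lt_def a0 normr_ge0.
have := aC (Num.truncn (C / `|a|)).+1; have := truncnS_gt (C / `|a|).
by rewrite ltr_pdivrMr // => h1 h2; have := lt_le_trans h1 h2; rewrite ltxx.
Qed.

Lemma quasimorphism_power f D : (forall x y, `|f (x * y)%g - f x - f y| <= D) ->
  forall x n, `|f (x ^+ n.+1)%g - n.+1%:R * f x| <= n%:R * D.
Proof.
move=> hf x; elim=> [|n IHn].
  by rewrite expg1 mul1r subrr normr0 mul0r.
have := hf x (x ^+ n.+1)%g; rewrite -expgS.
move: IHn; rewrite !ler_norml -!natr1 => /andP[? ?] /andP[? ?].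
by apply/andP; split; lra.
Qed.

(** L x is a supremum instead of a limit. Computing f on x^(mn) in two ways shows that every (f(x^n)
    - D)/n is at most every (f(x^m) + D)/m, and L x separates the two families. *)
Lemma homogenization_exists f D :
  (forall x y, `|f (x * y)%g - f x - f y| <= D) ->
  exists L : G -> R, forall x n, `|f (x ^+ n)%g - n%:R * L x| <= D.
Proof.
move=> hf; suff hL x : exists L, forall n, `|f (x ^+ n)%g - n%:R * L| <= D.
  by have /choice[L LP] := hL; exists L.
have le m n :
    m.+1%:R * (f (x ^+ n.+1)%g - D) <= n.+1%:R * (f (x ^+ m.+1)%g + D).
  have := quasimorphism_power hf (x ^+ m.+1)%g n.
  have := quasimorphism_power hf (x ^+ n.+1)%g m.
  rewrite -!expgnA mulnC !ler_norml -!natr1 => /andP[? ?] /andP[? ?].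
  have D0 : 0 <= D by apply: le_trans (hf x x).
  lra.
pose E := [set ((f (x ^+ n.+1)%g - D) / n.+1%:R) | n in setT]%classic.
have ubE m : ubound E ((f (x ^+ m.+1)%g + D) / m.+1%:R).
  move=> _ [n _ <-]; rewrite ler_pdivrMr ?ltr0n // mulrAC ler_pdivlMr ?ltr0n //.
  by have := le m n; lra.
have supE : has_sup E.
  split; first by exists ((f (x ^+ 1)%g - D) / 1), 0%N.
  by exists ((f (x ^+ 1)%g + D) / 1%:R); exact: ubE 0%N.
exists (sup E) => -[|n].
  by have := hf 1%g 1%g; rewrite mulg1 expg0 mul0r subrr sub0r normrN subr0.
have n0 : 0 < n.+1%:R :> R by rewrite ltr0n.
have lo : (f (x ^+ n.+1)%g - D) / n.+1%:R <= sup E.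
  by apply: (ub_le_sup supE.2); exists n.
have hi : sup E <= (f (x ^+ n.+1)%g + D) / n.+1%:R := ge_sup supE.1 (ubE n).
rewrite ler_pdivrMr // in lo; rewrite ler_pdivlMr // in hi.
by rewrite ler_norml; apply/andP; split; lra.
Qed.

Lemma homogeneous_unique (f g : G -> R) x C :
  (forall n : nat, f (x ^+ n)%g = n%:R * f x) ->
  (forall n : nat, g (x ^+ n)%g = n%:R * g x) ->
  (forall n : nat, `|f (x ^+ n)%g - g (x ^+ n)%g| <= C) -> f x = g x.
Proof.
move=> hf hg hC; apply/eqP; rewrite -subr_eq0; apply/eqP.
apply: (@eq0_of_bounded_multiples _ C) => n; have := hC n.
by rewrite hf hg -mulrBr normrM ger0_norm.
Qed.

Lemma homogeneous_of_expg f : quasimorphism f ->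
  (forall x (n : nat), f (x ^+ n)%g = n%:R * f x) -> homogeneous f.
Proof.
move=> [D hf] fX; have f1 : f 1%g = 0 by rewrite -(expg0 1%g) fX mul0r.
have fV x : f x^-1%g = - f x.
  apply/eqP; rewrite -addr_eq0; apply/eqP.
  apply: (@eq0_of_bounded_multiples _ D) => n.
  have := hf (x ^+ n)%g (x^-1 ^+ n)%g.
  rewrite expVgn mulgV f1 -expVgn !fX sub0r -opprD normrN -mulrDr normrM.
  by rewrite ger0_norm // addrC.
move=> x [n|n] /=; first by rewrite fX.
by rewrite fV fX NegzE mulrNz mulNr.
Qed.

Lemma homogenization f : quasimorphism f ->
  exists (h : hqm R G) (C : R), forall x, `|f x - val h x| <= C.
Proof.
move=> [D hf]; have [L hL] := homogenization_exists hf.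
have fL x : `|f x - L x| <= D by have := hL x 1%N; rewrite mul1r.
have Lqm : quasimorphism L.
  exists (4 * D) => x y.
  have := fL x; have := fL y; have := fL (x * y)%g; have := hf x y.
  rewrite !ler_norml => /andP[? ?] /andP[? ?] /andP[? ?] /andP[? ?].
  by apply/andP; split; lra.
have LX x (n : nat) : L (x ^+ n)%g = n%:R * L x.
  apply/eqP; rewrite -subr_eq0; apply/eqP.
  apply: (@eq0_of_bounded_multiples _ (2 * D)) => k.
  have := hL x (n * k)%N; have := hL (x ^+ n)%g k.
  rewrite -expgnA natrM -[X in X * `|_|]ger0_norm // -normrM.
  rewrite !ler_norml => /andP[? ?] /andP[? ?].
  by apply/andP; split; lra.
have Lh : L \in @hqm_pred R G.
  by apply/asboolP; split=> //; exact: homogeneous_of_expg.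
by exists (exist _ L Lh), D.
Qed.

End Homogenization.

Lemma hqm_quasimorphism (R : realType) (G : groupType) (h : hqm R G) :
  exists D, forall x y, `|(val h (x * y)%g : R) - val h x - val h y| <= D.
Proof. by have /asboolP[] := valP h. Qed.

Lemma hqm_expg (R : realType) (G : groupType) (h : hqm R G) x (n : nat) :
  val h (x ^+ n)%g = n%:R * val h x :> R.
Proof. by have /asboolP[_ /(_ x n)] := valP h. Qed.

(** * Quasigeodesics in hyperbolic spaces *)

Lemma linear_le_exp2 (m k : nat) : (2 * m <= k -> m * k.+1 <= 2 ^ k)%N.
Proof.
elim: k => [|k IHk]; first by case: m.
rewrite leq_eqVlt => /orP[/eqP mk|]; last first.
  by rewrite ltnS => /IHk; rewrite expnS; nia.
rewrite -mk; elim: m {k IHk mk} => // m IHm.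
by case: m IHm => // m; rewrite !mulnS !expnD; nia.
Qed.

(** Used to bound D when 2D is at most a constant plus a multiple of log D. For large D the choice k
    = D/(e+1) satisfies the exponential condition, and then k e <= D leaves D <= r. *)
Lemma le_of_linear_exp2 (a b e r : nat) : exists D0, forall D,
  (forall k, a * D + b <= 2 ^ k -> 2 * D <= r + k * e)%N -> (D <= D0)%N.
Proof.
pose m := (a * e.+1 + b)%N.
exists (maxn r (e.+1 * (2 * m).+1)) => D hD; rewrite leq_max.
have Dk : (D < e.+1 * (D %/ e.+1).+1)%N by rewrite mulnC ltn_ceil.
have kD : (D %/ e.+1 * e.+1 <= D)%N by rewrite leq_divM.
set k := (D %/ e.+1)%N in Dk kD.
have [mk|/ltnW km] := leqP (2 * m) k; last by apply/orP; right; nia.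
have := hD k; have := linear_le_exp2 mk; rewrite /m => h1 h2.
apply/orP; left; have : (a * D + b <= 2 ^ k)%N by nia.
by move=> /h2; nia.
Qed.

Section Morse.
Variables (T : Type) (d : T -> T -> nat).
Hypothesis dxx : forall x, d x x = 0%N.
Hypothesis dC : forall x y, d x y = d y x.
Hypothesis d_tri : forall y x z, (d x z <= d x y + d y z)%N.
Hypothesis d_geo : forall x y k, (k <= d x y)%N ->
  exists2 z, d x z = k & d z y = (d x y - k)%N.
Variable delta : nat.
Hypothesis d_hyp : forall w x y z,
  (d x z + d w y <= maxn (d x y + d w z) (d y z + d w x) + delta)%N.

(** The inequalities say that twice the Gromov product at p is at least B. Each use of the
    four-point condition costs delta, and bisecting a chain of at most 2^k steps takes k levels. *)
Lemma gromov_product_chain (p : T) (B k : nat) (y : nat -> T) (n : nat) :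
  (0 < n <= 2 ^ k)%N ->
  (forall i, (i < n)%N ->
     (d (y i) (y i.+1) + B <= d p (y i) + d p (y i.+1))%N) ->
  (d (y 0%N) (y n) + B <= d p (y 0%N) + d p (y n) + k * delta)%N.
Proof.
elim: k => [|k IHk] in y n *.
  by case: n => [|[|n]] // _ /(_ 0%N isT); rewrite mul0n addn0.
move=> /andP[n0 nk] hy; have [nk'|kn] := leqP n (2 ^ k).
  have := IHk y n _ hy; rewrite n0 nk' => /(_ isT) h.
  by apply: leq_trans h _; rewrite mulSn; lia.
have := IHk y (2 ^ k)%N; rewrite leqnn expn_gt0 /= => /(_ isT) h1.
have {}h1 := h1 (fun i ik => hy i (ltn_trans ik kn)).
have := IHk (fun i => y (2 ^ k + i)%N) (n - 2 ^ k)%N.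
rewrite addn0 subnKC; last exact: ltnW.
have -> : (0 < n - 2 ^ k <= 2 ^ k)%N by rewrite expnS in nk; lia.
move=> /(_ isT) h2.
have {}h2 : (d (y (2 ^ k)%N) (y n) + B
    <= d p (y (2 ^ k)%N) + d p (y n) + k * delta)%N.
  by apply: h2 => i ik; rewrite addnS; apply: hy; lia.
have := d_hyp p (y 0%N) (y (2 ^ k)%N) (y n).
by rewrite mulSn; lia.
Qed.

Variables (lambda mu rho : nat).

Definition quasigeodesic (n : nat) (x : nat -> T) : Prop :=
  (forall i, (i < n)%N -> (d (x i) (x i.+1) <= 1)%N) /\
  (forall i j, (i <= j <= n)%N -> (j - i <= lambda * d (x i) (x j) + mu)%N).

(* The path y, x_i, .., x_j, z avoids the D-ball around the point p, which    *)
(* lies between its endpoints, although its length is only linear in D.       *)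
Lemma detour_bound n x p D y z i j k : quasigeodesic n x ->
  (forall l, (l <= n)%N -> (D <= d p (x l))%N) -> (i <= j <= n)%N ->
  (d p y <= 2 * D)%N -> (d p z <= 2 * D)%N ->
  (d y (x i) <= D)%N -> (d z (x j) <= D)%N ->
  (d y (x i) + 2 * D <= d p y + d p (x i))%N ->
  (d z (x j) + 2 * D <= d p z + d p (x j))%N ->
  (d p y + d p z <= d y z + rho)%N ->
  (6 * lambda * D + mu.+2 <= 2 ^ k)%N ->
  (2 * D <= rho.+1 + k * delta)%N.
Proof.
move=> [x1 xq] far /andP[ij jn] py pz yi zj yi2 zj2 yz hk.
pose s l :=
  if l is l'.+1 then if (l' <= j - i)%N then x (i + l')%N else z else y.
(* Through y, p and z, the distance from x_i to x_j is at most D + 2D + 2D + D. *)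
have ijl : (j - i <= 6 * lambda * D + mu)%N.
  have := xq i j; rewrite ij jn => /(_ isT) /leq_trans; apply.
  rewrite leq_add2r -mulnA [(6 * _)%N]mulnC -mulnA leq_mul2l; apply/orP; right.
  have := d_tri y (x i) (x j); have := d_tri z y (x j); have := d_tri p y z.
  by rewrite (dC (x i) y) (dC y p); lia.
(* Consecutive points of x are at least D from p and at most 1 apart, whence 2D - 1. *)
have := @gromov_product_chain p (2 * D - 1) k s (j - i).+2.
have -> : (0 < (j - i).+2 <= 2 ^ k)%N by lia.
rewrite /s ltnn => /(_ isT) h.
suff /h : forall l, (l < (j - i).+2)%N ->
    (d (s l) (s l.+1) + (2 * D - 1) <= d p (s l) + d p (s l.+1))%N by lia.
move=> {h} [_|l]; first by rewrite /s /= addn0; lia.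
rewrite !ltnS => lij; rewrite /s lij.
have [lj|lj] := ltnP l (j - i).
  have lt_n : (i + l < n)%N by lia.
  have := x1 _ lt_n; have := far _ lt_n; have := far _ (ltnW lt_n).
  have := d_tri p (x (i + l)%N) (x (i + l).+1); rewrite (dC _ p).
  by rewrite addnS; lia.
have -> : (i + l)%N = j by lia.
by rewrite (dC _ z); lia.
Qed.

(** Among the points almost between the endpoints, take p whose distance D to the path is largest;
    every other such point is then within D of the path. Going 2D from p towards each endpoint, and
    from there at most D to the path, gives a detour around p, so [detour_bound] and
    [le_of_linear_exp2] bound D. *)
Lemma morse : exists C, forall n x p, quasigeodesic n x ->
  (d (x 0%N) p + d p (x n) <= d (x 0%N) (x n) + rho)%N ->
  exists2 i, (i <= n)%N & (d p (x i) <= C)%N.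
Proof.
have [C hC] := le_of_linear_exp2 (6 * lambda) mu.+2 delta rho.+1.
exists C => n x p0 xq P0.
pose P p := (d (x 0%N) p + d p (x n) <= d (x 0%N) (x n) + rho)%N.
pose E D := `[< exists2 p, P p & forall i, (i <= n)%N -> (D <= d p (x i))%N >].
have exE : exists D, E D by exists 0%N; apply/asboolP; exists p0.
have ubE D : E D -> (D <= d (x 0%N) (x n) + rho)%N.
  move=> /asboolP[p]; rewrite /P => hp /(_ 0%N isT); rewrite dC; lia.
case: (ex_maxnP exE ubE) => D /asboolP[p Pp far] maxD.
have near y : P y -> exists2 i, (i <= n)%N & (d y (x i) <= D)%N.
  move=> Py; apply: contrapT => h.
  suff /maxD : E D.+1 by rewrite ltnn.
  apply/asboolP; exists y => // i i_n; rewrite ltnNge; apply/negP => yi.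
  by apply: h; exists i.
suff DC : (D <= C)%N.
  by have [i i_n pi] := near _ P0; exists i => //; exact: leq_trans pi DC.
(* walk from p towards an endpoint e of x, by 2D or until e is reached *)
have side e : (e <= n)%N ->
    (forall y, d p y + d y (x e) = d p (x e) -> P y)%N ->
    exists y i, [/\ (i <= n)%N, (d p y + d y (x e) = d p (x e))%N,
      (d p y <= 2 * D)%N, (d y (x i) <= D)%N
      & (d y (x i) + 2 * D <= d p y + d p (x i))%N].
  move=> en Pe; have [le|gt] := leqP (d p (x e)) (2 * D).
    by exists (x e), e; rewrite dxx; split=> //; have := far e en; lia.
  have [y y1 y2] := d_geo (ltnW gt).
  have ye : (d p y + d y (x e) = d p (x e))%N by lia.
  have [i i_n yi] := near y (Pe y ye).
  by exists y, i; split=> //; have := far i i_n; lia.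
have [y py|y [i [i_n ye yD yi yi2]]] := side 0%N isT.
  have := d_tri p y (x n); have := dC y p; have := dC (x 0%N) y.
  by have := dC (x 0%N) p; rewrite /P in Pp *; lia.
have [z pz|z [j [j_n ze zD zj zj2]]] := side n (leqnn n).
  by have := d_tri p (x 0%N) z; rewrite /P in Pp *; lia.
have yz : (d p y + d p z <= d y z + rho)%N.
  have := d_tri y (x 0%N) (x n); have := d_tri z y (x n).
  have := dC (x 0%N) y; have := dC (x 0%N) p; rewrite /P in Pp.
  by lia.
apply: hC => k hk; have [ij|/ltnW ji] := leqP i j.
  by apply: (@detour_bound n x p D y z i j) => //; rewrite ij.
apply: (@detour_bound n x p D z y j i) => //; first by rewrite ji.
by rewrite addnC (dC z).
Qed.

End Morse.

(** * Word metrics and Dehn's algorithm *)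

Section WordLength.
Local Open Scope group_scope.
Variables (G : groupType) (S : seq G) (genS : generates S).

Definition letter (s : G) : bool := (s \in S) || (s^-1 \in S).

Definition eval (w : seq G) : G := \prod_(s <- w) s.

Local Notation "`[ g ]" := (word_length genS g) (format "`[ g ]").

Lemma eval_nil : eval [::] = 1. Proof. exact: big_nil. Qed.

Lemma eval_cons s w : eval (s :: w) = s * eval w.
Proof. exact: big_cons. Qed.

Lemma eval_cat u v : eval (u ++ v) = eval u * eval v.
Proof. exact: big_cat. Qed.

Definition inv_word (w : seq G) : seq G := rev (map (fun s => s^-1) w).

Lemma eval_inv_word w : eval (inv_word w) = (eval w)^-1.
Proof.
elim: w => [|s w IHw]; first by rewrite /inv_word /= eval_nil invg1.
rewrite /inv_word /= rev_cons -cats1 eval_cat -/(inv_word w) IHw.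
by rewrite !eval_cons eval_nil mulg1 invgM.
Qed.

Lemma letter_inv_word w : all letter w -> all letter (inv_word w).
Proof.
rewrite all_rev all_map; apply: sub_all => s /=.
by rewrite /letter invgK orbC.
Qed.

Lemma size_inv_word w : size (inv_word w) = size w.
Proof. by rewrite size_rev size_map. Qed.

Lemma word_length_le w : all letter w -> (`[eval w] <= size w)%N.
Proof.
move=> lw; rewrite /word_length; case: ex_minnP => m _; apply.
by apply/asboolP; exists w.
Qed.

Lemma geodesic_word g : exists w, [/\ all letter w, size w = `[g] & eval w = g].
Proof.
rewrite /word_length; case: ex_minnP => m /asboolP[w [lw sw ew]] _.
by exists w.
Qed.

Lemma word_length1 : `[1] = 0%N.
Proof. by apply/eqP; rewrite -leqn0 -eval_nil word_length_le. Qed.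

Lemma word_lengthM g h : (`[(g * h)%g] <= `[g] + `[h])%N.
Proof.
have [u [lu <- <-]] := geodesic_word g; have [v [lv <- <-]] := geodesic_word h.
by rewrite -eval_cat -size_cat word_length_le // all_cat lu.
Qed.

Lemma word_lengthV g : `[g^-1] = `[g].
Proof.
suff le h : (`[h^-1] <= `[h])%N.
  by apply/eqP; rewrite eqn_leq le -{1}[g]invgK le.
have [u [lu <- <-]] := geodesic_word h.
by rewrite -eval_inv_word -size_inv_word word_length_le // letter_inv_word.
Qed.

Lemma word_length_split g k : (k <= `[g])%N ->
  exists2 p, `[p] = k & `[p^-1 * g] = (`[g] - k)%N.
Proof.
move=> kg; have [u [lu su eu]] := geodesic_word g.
have := word_length_le (w := take k u).
have := word_length_le (w := drop k u).
have t1 : (`[eval (take k u)] <= size (take k u))%N.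
  by apply: word_length_le; apply/allP => s /mem_take/(allP lu).
have d1 : (`[eval (drop k u)] <= size (drop k u))%N.
  by apply: word_length_le; apply/allP => s /mem_drop/(allP lu).
have eu' : eval (take k u) * eval (drop k u) = g.
  by rewrite -eval_cat cat_take_drop.
exists (eval (take k u)).
  have := word_lengthM (eval (take k u)) (eval (drop k u)).
  rewrite eu'; rewrite size_drop size_take_min in d1 t1; lia.
have -> : (eval (take k u))^-1 * g = eval (drop k u) by rewrite -eu' mulKg.
have := word_lengthM (eval (take k u)) (eval (drop k u)).
rewrite eu'; rewrite size_drop size_take_min in d1 t1; lia.
Qed.

Lemma word_dist_tri y x z :
  (word_dist genS x z <= word_dist genS x y + word_dist genS y z)%N.
Proof.
rewrite /word_dist -[(x^-1 * z)%g](_ : (x^-1 * y) * (y^-1 * z) = _).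
  exact: word_lengthM.
by rewrite mulgA mulgK.
Qed.

Lemma word_distxx x : word_dist genS x x = 0%N.
Proof. by rewrite /word_dist mulVg word_length1. Qed.

Lemma word_distC x y : word_dist genS x y = word_dist genS y x.
Proof. by rewrite /word_dist -word_lengthV invgM invgK. Qed.

Lemma word_dist1 x : word_dist genS 1 x = `[x].
Proof. by rewrite /word_dist invg1 mul1g. Qed.

Lemma word_dist_geodesic x y k : (k <= word_dist genS x y)%N ->
  exists2 z, word_dist genS x z = k
    & word_dist genS z y = (word_dist genS x y - k)%N.
Proof.
move=> /word_length_split[p p1 p2]; exists (x * p).
  by rewrite /word_dist mulKg.
by rewrite {1}/word_dist invgM -mulgA p2.
Qed.

Lemma word_dist_le_size w i j : all letter w -> (i <= j <= size w)%N ->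
  (word_dist genS (eval (take i w)) (eval (take j w)) <= j - i)%N.
Proof.
move=> lw /andP[ij jw].
have -> : take j w = take i w ++ take (j - i) (drop i w).
  by rewrite -takeD subnKC.
rewrite eval_cat /word_dist mulKg.
apply: leq_trans (word_length_le _) _.
  by apply/allP => s /mem_take/mem_drop/(allP lw).
by rewrite size_take_min geq_minl.
Qed.

Lemma bounded_on_words (R : realType) (f : seq G -> R) (m : nat) :
  exists K : nat, forall w, all letter w -> (size w <= m)%N -> `|f w| <= K%:R.
Proof.
elim: m f => [|m IHm] f.
  exists (Num.truncn `|f [::]|).+1 => w _; rewrite leqn0 => /nilP ->.
  exact/ltW/truncnS_gt.
pose A := S ++ map (fun s => s^-1) S.
have letA s : letter s -> s \in A.
  rewrite mem_cat => /orP[->//|sS]; apply/orP; right.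
  by apply/mapP; exists s^-1; rewrite ?invgK.
have [K hK] : exists K : nat, forall s w, s \in A -> all letter w ->
    (size w <= m)%N -> `|f (s :: w)| <= K%:R.
  elim: A {letA} => [|a A [K hK]]; first by exists 0%N.
  have [L hL] := IHm (fun w => f (a :: w)).
  exists (maxn K L) => s w; rewrite inE => /orP[/eqP->|sA] lw sw.
    by apply: le_trans (hL w lw sw) _; rewrite ler_nat leq_maxr.
  by apply: le_trans (hK s w sA lw sw) _; rewrite ler_nat leq_maxl.
have [L hL] := IHm f.
exists (maxn K L) => -[|s w] /=.
  by move=> _ _; apply: le_trans (hL [::] isT isT) _; rewrite ler_nat leq_maxr.
move=> /andP[/letA sA lw] sw; apply: le_trans (hK s w sA lw sw) _.
by rewrite ler_nat leq_maxl.
Qed.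

Variable delta : nat.
Hypothesis hyp : forall w x y z, (word_dist genS x z + word_dist genS w y <=
  maxn (word_dist genS x y + word_dist genS w z)
       (word_dist genS y z + word_dist genS w x) + delta)%N.

(* By hyperbolicity, the two points delta + 1 steps before and after the      *)
(* point of the loop that is farthest from the base point are close.          *)
Lemma dehn_shortcut w : all letter w -> eval w = 1 ->
  (2 * delta.+1 <= size w)%N ->
  exists u v u', [/\ w = u ++ v ++ u', size v = (2 * delta.+1)%N
                  & (`[eval v] < size v)%N].
Proof.
set k := delta.+1 => lw w1 kw.
pose x i := eval (take i w).
suff [i ik ix] : exists2 i, (i + 2 * k <= size w)%N
    & (word_dist genS (x i) (x (i + 2 * k)%N) < 2 * k)%N.
  exists (take i w), (take (2 * k) (drop i w)), (drop (i + 2 * k) w).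
  have sz : size (take (2 * k) (drop i w)) = (2 * k)%N.
    by rewrite size_takel // size_drop; lia.
  split=> //; first by rewrite catA -takeD cat_take_drop.
  rewrite sz; move: ix; rewrite /x takeD eval_cat.
  by rewrite /word_dist mulKg.
have dx i j : (i <= j <= size w)%N -> (word_dist genS (x i) (x j) <= j - i)%N.
  exact: word_dist_le_size.
have x0 : x 0%N = 1 by rewrite /x take0 eval_nil.
have xn : x (size w) = 1 by rewrite /x take_size.
have [m mw maxm] : exists2 m, (m <= size w)%N
    & forall i, (i <= size w)%N -> (`[x i] <= `[x m])%N.
  have [[m mw] _ maxm] := @arg_maxnP 'I_(size w).+1 ord0 xpredT
    (fun i => `[x i]) isT.
  by exists m => [|i iw]; [|exact: (maxm (Ordinal (iw : (i < (size w).+1)%N)))].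
have mle : (`[x m] <= minn m (size w - m))%N.
  rewrite leq_min -word_dist1 -{1}x0 -xn.
  rewrite [word_dist _ _ (x m) in X in _ && X]word_distC.
  by apply/andP; split; [have := dx 0%N m | have := dx m (size w)];
    rewrite ?subn0; apply; rewrite ?leqnn ?mw.
(* If the farthest point is fewer than k steps from an end of the loop, the whole loop stays closer
   than k to 1, and its first 2k letters can be shortened. *)
have [km|mk] := boolP ((k <= m) && (m + k <= size w))%N; last first.
  exists 0%N => //; rewrite add0n x0 word_dist1.
  by apply: leq_ltn_trans (maxm _ kw) _; lia.
case/andP: km => km mkw; exists (m - k)%N; first by lia.
have -> : (m - k + 2 * k = m + k)%N by lia.
(* As x_m is farthest from 1, the four-point condition leaves a distance of at most k + delta = 2k -
   1. *)
have := hyp 1 (x (m - k)%N) (x m) (x (m + k)%N); rewrite !word_dist1.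
have := maxm (m - k)%N; have := maxm (m + k)%N mkw.
have := dx (m - k)%N m; have := dx m (m + k)%N.
rewrite mkw leq_addr mw leq_subr.
move=> /(_ isT) d1 /(_ isT) d2 m1 m2.
have {}m2 := m2 (leq_trans (leq_subr _ _) mw).
rewrite /k in d1 d2 m1 m2 km *; lia.
Qed.

End WordLength.

(** * Bounded representatives of 2-cocycles on hyperbolic groups *)

Section BoundedRepresentative.
Variables (R : realType) (G : groupType) (S : seq G) (genS : generates S).
Variable delta : nat.
Hypothesis hyp : forall w x y z, (word_dist genS x z + word_dist genS w y <=
  maxn (word_dist genS x y + word_dist genS w z)
       (word_dist genS y z + word_dist genS w x) + delta)%N.
Variable c : G -> G -> R.
Hypothesis cC : cocycle2 c.

Local Notation "`[ g ]" := (word_length genS g) (format "`[ g ]").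
Local Notation letters := (all (letter S)).

Lemma cocycle1g x : c 1%g x = c 1%g 1%g.
Proof. by have := cC 1%g 1%g x; rewrite !mul1g; lra. Qed.

Lemma cocycleg1 x : c x 1%g = c 1%g 1%g.
Proof. by have := cC x 1%g 1%g; rewrite !mulg1; lra. Qed.

(* In the central extension of G by R with cocycle c, the lifts (0, s) of the *)
(* letters s of w multiply to (holonomy w, eval w).                           *)
Fixpoint holonomy (w : seq G) : R :=
  if w is s :: w' then holonomy w' + c s (eval w') else - c 1%g 1%g.

(** Multiplication in the central extension, whose identity is (- c 1 1, 1); this explains the value
    on the empty word. *)
Lemma holonomy_cat u v :
  holonomy (u ++ v) = holonomy u + holonomy v + c (eval u) (eval v).
Proof.
elim: u => [|s u IHu] /=; first by rewrite eval_nil cocycle1g; ring.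
by rewrite IHu eval_cat eval_cons; have := cC s (eval u) (eval v); lra.
Qed.

(** Replacing the subword of [dehn_shortcut] by a geodesic shortens the loop by at least 1 and
    changes the holonomy by at most 2K, where K bounds it on words of length at most 2(delta +
    1). *)
Lemma linear_isoperimetric : exists K : nat, forall w, letters w ->
  eval w = 1%g -> `|holonomy w| <= K%:R * (size w)%:R + K%:R.
Proof.
have [K hK] := bounded_on_words S holonomy (2 * delta.+1).
exists (2 * K)%N => w; rewrite natrM; move: {2}(size w) (leqnn (size w)) => m.
have K0 : 0 <= K%:R :> R by [].
elim: m w => [|m IHm] w wm lw w1; have w0 : 0 <= (size w)%:R :> R by [].
- by have := hK w lw (leq_trans wm (leq0n _)); nra.
have [short|long] := leqP (size w) (2 * delta.+1).
  by have := hK w lw short; nra.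
have [u [v [u' [wE sv evv]]]] := dehn_shortcut hyp lw w1 (ltnW long).
have [v' [lv' sv' ev']] := geodesic_word genS (eval v).
move: lw wm w1; rewrite wE !all_cat !size_cat => /and3P[lu lv lu'] wm w1.
have := IHm (u ++ v' ++ u'); rewrite !all_cat !size_cat lu lv' lu' sv'.
have -> : (size u + (`[eval v] + size u') <= m)%N by lia.
have -> : eval (u ++ v' ++ u') = 1%g by rewrite !eval_cat ev' -!eval_cat.
move=> /(_ isT isT erefl); rewrite !holonomy_cat !eval_cat ev'.
have sv2 : (size v <= 2 * delta.+1)%N by rewrite sv.
have := hK v lv sv2.
have sv'2 : (size v' <= 2 * delta.+1)%N by lia.
have := hK v' lv' sv'2.
have : 0 <= K%:R * ((size v)%:R - (`[eval v]%:R + 1)) :> R.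
  by rewrite mulr_ge0 // subr_ge0 natr1 ler_nat.
rewrite !natrD !ler_norml.
move=> ? /andP[? ?] /andP[? ?] /andP[? ?].
by apply/andP; split; lra.
Qed.

(** Close both w and w' with the inverse word of w': the two loops have total length |w| + 3|w'|,
    and their cocycle corrections cancel in the difference. *)
Lemma holonomy_compare : exists K : nat, forall w w', letters w -> letters w' ->
  eval w = eval w' ->
  `|holonomy w - holonomy w'| <= K%:R * ((size w)%:R + 3 * (size w')%:R + 2).
Proof.
have [K hK] := linear_isoperimetric; exists K => w w' lw lw' ww'.
have lv := letter_inv_word lw'; have sv := size_inv_word w'.
have ev := eval_inv_word w'.
have := hK (w ++ inv_word w'); have := hK (w' ++ inv_word w').
rewrite !all_cat lw lw' lv !eval_cat ev ww' mulgV !holonomy_cat ev ww'.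
move=> /(_ isT erefl) h1 /(_ isT erefl) h2.
rewrite !size_cat sv !natrD !ler_norml in h1 h2 *.
move: h1 h2 => /andP[? ?] /andP[? ?].
by apply/andP; split; lra.
Qed.

Section Potential.
Variable K : nat.
Hypothesis hK : forall w w', letters w -> letters w' -> eval w = eval w' ->
  `|holonomy w - holonomy w'| <= K%:R * ((size w)%:R + 3 * (size w')%:R + 2).

Definition cost (w : seq G) : R := holonomy w - K.+1%:R * (size w)%:R.

Definition potential (g : G) : R :=
  sup [set cost w | w in [set w | letters w /\ eval w = g]]%classic.

Lemma has_sup_cost g :
  has_sup [set cost w | w in [set w | letters w /\ eval w = g]]%classic.
Proof.
have [w' [lw' _ ew']] := geodesic_word genS g; split.
  by exists (cost w'), w'.
exists (holonomy w' + K%:R * (3 * (size w')%:R + 2)) => _ [w [lw ew] <-].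
have := hK lw lw' (etrans ew (esym ew')); rewrite /cost ler_norml.
by move=> /andP[_]; rewrite -natr1; have : 0 <= (size w)%:R :> R by []; lra.
Qed.

Lemma potential_ge w : letters w -> cost w <= potential (eval w).
Proof. by move=> lw; apply: (ub_le_sup (has_sup_cost _).2); exists w. Qed.

Lemma potential_adherent g :
  exists w, [/\ letters w, eval w = g & potential g <= cost w + 1].
Proof.
have [_ [w [lw ew] <-] /ltW] := sup_adherent ltr01 (has_sup_cost g).
by rewrite lerBlDr => ?; exists w.
Qed.

Lemma potential_superadditive g h :
  potential g + potential h + c g h <= potential (g * h)%g.
Proof.
rewrite -lerBrDr -lerBrDr; apply: ge_sup (has_sup_cost g).1 _.
move=> _ [u [lu ug] <-]; rewrite lerBrDr addrC -lerBrDr.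
apply: ge_sup (has_sup_cost h).1 _.
move=> _ [v [lv vh] <-].
have := @potential_ge (u ++ v); rewrite all_cat lu lv eval_cat ug vh.
move=> /(_ isT); rewrite /cost holonomy_cat ug vh size_cat natrD; lra.
Qed.

(** Replacing a subword u by a geodesic u' saves (K+1)(|u| - |u'|), loses at most K(|u| + 3|u'| + 2)
    in holonomy, and can gain at most 1. The spare unit of slope leaves |u| <= (4K+1)|u'| + 2K +
    1. *)
Lemma almost_optimal_quasigeodesic w : letters w ->
  potential (eval w) <= cost w + 1 ->
  quasigeodesic (word_dist genS) (4 * K).+1 (2 * K).+1 (size w)
    (fun i => eval (take i w)).
Proof.
move=> lw opt; split=> [i iw|i j /andP[ij jw]].
  have := word_dist_le_size genS (i := i) (j := i.+1) lw.
  by rewrite leqnSn iw subSnn; exact.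
pose u := take (j - i) (drop i w).
have wE : w = take i w ++ u ++ drop j w.
  by rewrite catA -takeD subnKC // cat_take_drop.
have su : size u = (j - i)%N by rewrite size_takel // size_drop leq_sub2r.
rewrite -{2}[j](subnKC ij) takeD eval_cat -/u {1}/word_dist mulKg -su.
have [u' [lu' <- eu']] := geodesic_word genS (eval u).
move: lw; rewrite [w in all _ w]wE !all_cat => /and3P[li lu lj].
have := @potential_ge (take i w ++ u' ++ drop j w).
rewrite !all_cat li lu' lj !eval_cat eu' -!eval_cat -wE => /(_ isT) /le_trans.
have opt' : potential (eval w) <= cost (take i w ++ u ++ drop j w) + 1.
  by rewrite -wE.
move=> /(_ _ opt'); rewrite /cost !holonomy_cat !eval_cat eu' !size_cat !natrD.
have := hK lu lu' (esym eu'); rewrite ler_norml => /andP[_].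
move=> h1 h2; rewrite -(ler_nat R) natrD natrM -!natr1 !natrM.
rewrite -natr1 in h2; nra.
Qed.

Definition defect g h : R :=
  potential (g * h)%g - potential g - potential h - c g h.

Lemma defect_ge0 g h : 0 <= defect g h.
Proof. by have := potential_superadditive g h; rewrite /defect; lra. Qed.

(** As g lies almost between 1 and gh, [morse] makes a near-optimal word for gh pass through some x
    = g y with y in a fixed ball. Cutting the word at x and moving the cut to g by superadditivity
    costs only [backtrack] of y, which is bounded on that ball. *)
Lemma defect_bounded (rho : nat) : exists C, forall g h,
  (`[g] + `[h] <= `[(g * h)%g] + rho)%N -> defect g h <= C.
Proof.
have [C0 hC0] := morse (word_distxx genS) (word_distC genS)
  (word_dist_tri genS) (@word_dist_geodesic _ _ genS) hyp
  (4 * K).+1 (2 * K).+1 rho.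
pose backtrack (v : seq G) := let y := eval v in
  potential y + potential y^-1%g + c y y^-1%g.
have [C hC] := bounded_on_words S backtrack C0.
exists (1 - c 1%g 1%g + C%:R) => g h gh.
have [w [lw ew wopt]] := potential_adherent (g * h)%g.
have := wopt; rewrite -{1}ew => /(almost_optimal_quasigeodesic lw) wq.
have := hC0 _ _ g wq; rewrite take0 take_size eval_nil ew !word_dist1.
rewrite {1}/word_dist mulKg => /(_ gh) [i iw].
set x := eval (take i w) => gx.
pose y := (g^-1 * x)%g.
have [v [lv sv ev]] := geodesic_word genS y.
have := hC v lv; rewrite sv => /(_ gx); rewrite /backtrack ev ler_norml.
move=> /andP[lo _].
have lt : letters (take i w) by apply/allP => s /mem_take/(allP lw).
have ld : letters (drop i w) by apply/allP => s /mem_drop/(allP lw).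
have xE : x = (g * y)%g by rewrite mulVKg.
have xy : (x * y^-1)%g = g by rewrite xE mulgK.
have dE : eval (drop i w) = (y^-1 * h)%g.
  by apply: (@mulgI _ x); rewrite -eval_cat cat_take_drop ew mulgA xy.
have := potential_ge lt; have := potential_ge ld.
rewrite -[w in cost w](cat_take_drop i w) {1}/cost in wopt.
rewrite holonomy_cat size_cat natrD dE -/x in wopt *; rewrite /cost.
have := potential_superadditive x y^-1%g.
have := potential_superadditive y (y^-1 * h)%g.
rewrite mulVKg xy => h1 h2 h3 h4.
have := cC x y^-1%g h; have := cC y y^-1%g h.
rewrite mulgV cocycle1g xy /defect.
by lra.
Qed.

(** The defect is itself a 2-cocycle. The bracket is the only term not controlled at a centre of the
    triangle, and it depends on q alone. *)
Lemma defect_triangle p q r :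
  defect (p * q)%g (q^-1 * r)%g = defect p r - defect p q - defect q^-1%g r
    - (potential q + potential q^-1%g + c q q^-1%g + c 1%g 1%g).
Proof.
rewrite /defect mulgA mulgK.
have := cC (p * q)%g q^-1%g r; have := cC p q q^-1%g.
by rewrite mulgK mulgV cocycleg1; lra.
Qed.

(** The centre p lies on a geodesic from 1 to g, at a distance equal to the Gromov product of g and
    gh at 1, rounded down; rounding accounts for the 1 in [delta.+1]. *)
Lemma triangle_centre g h : exists p q r,
  [/\ g = (p * q)%g, h = (q^-1 * r)%g, (`[p] + `[q] <= `[g] + delta.+1)%N,
      (`[q] + `[r] <= `[h] + delta.+1)%N
    & (`[p] + `[r] <= `[(g * h)%g] + delta.+1)%N].
Proof.
pose f := (g * h)%g; rewrite -/f.
pose k := ((`[g] + `[f] - `[h]) %/ 2)%N.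
have tri1 : (`[f] <= `[g] + `[h])%N := word_lengthM genS g h.
have tri2 : (`[h] <= `[g] + `[f])%N.
  by rewrite -(word_lengthV genS g) -{1}(mulKg g h); exact: word_lengthM.
have tri3 : (`[g] <= `[f] + `[h])%N.
  by rewrite -(word_lengthV genS h) -{1}(mulgK h g); exact: word_lengthM.
have [|p pk] := @word_length_split _ _ genS g k; first by rewrite /k; lia.
have qh : (p^-1 * f = (p^-1 * g) * h)%g by rewrite mulgA.
move: (p^-1 * g)%g (mulVKg p g) qh => q qE qh qk.
exists p, q, (q * h)%g; rewrite qE mulKg.
have := hyp 1%g p g f; rewrite !word_dist1.
have -> : word_dist genS p f = `[(q * h)%g] by rewrite -qh.
have -> : word_dist genS p g = `[q] by rewrite -qE /word_dist mulKg.
have -> : word_dist genS g f = `[h] by rewrite /word_dist mulKg.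
by move=> four; split=> //; rewrite /k in pk qk; lia.
Qed.

Lemma bounded_representative_of_potential : exists (psi : G -> R) (D : R),
  forall g h, `|psi g + psi h - psi (g * h)%g + c g h| <= D.
Proof.
have [C hC] := defect_bounded delta.+1.
(* Up to a constant, this averages the section of the extension given by the potential with g |->
   s(g^-1)^-1. The triangle of h^-1 and g^-1 has the same middle element q, so the uncontrolled
   brackets cancel. *)
pose psi g := (potential g - potential g^-1%g - c g g^-1%g) / 2.
exists psi, (2 * C + `|c 1%g 1%g|) => g h.
have [p [q [r [gE hE pq qr pr]]]] := triangle_centre g h.
have psiE : 2 * (psi g + psi h - psi (g * h)%g + c g h)
    = defect h^-1%g g^-1%g - defect g h + c 1%g 1%g.
  rewrite /psi /defect invgM.
  have := cC (g * h)%g h^-1%g g^-1%g; have := cC g h h^-1%g.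
  by rewrite mulgV cocycleg1 mulgK; lra.
have := defect_triangle p q r; rewrite -gE -hE.
have := defect_triangle r^-1%g q p^-1%g.
have -> : (r^-1 * q)%g = h^-1%g by rewrite hE invgM invgK.
have -> : (q^-1 * p^-1)%g = g^-1%g by rewrite gE invgM.
have hrq : `[(r^-1 * q)%g] = `[h] by rewrite -word_lengthV hE invgM invgK.
have gpq : `[(q^-1 * p^-1)%g] = `[g] by rewrite -invgM word_lengthV gE.
have prE : (p * r = g * h)%g by rewrite gE hE -mulgA mulVKg.
have ghpr : `[(r^-1 * p^-1)%g] = `[(g * h)%g].
  by rewrite -invgM word_lengthV prE.
have d1 : defect p q <= C by apply: hC; rewrite -gE.
have d2 : defect q^-1%g r <= C by apply: hC; rewrite word_lengthV -hE.
have d3 : defect p r <= C by apply: hC; rewrite prE.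
have d4 : defect r^-1%g q <= C by apply: hC; rewrite hrq word_lengthV addnC.
have d5 : defect q^-1%g p^-1%g <= C.
  by apply: hC; rewrite gpq !word_lengthV addnC.
have d6 : defect r^-1%g p^-1%g <= C.
  by apply: hC; rewrite ghpr !word_lengthV addnC.
have := (defect_ge0 p q, defect_ge0 q^-1%g r, defect_ge0 p r).
have := (defect_ge0 r^-1%g q, defect_ge0 q^-1%g p^-1%g,
  defect_ge0 r^-1%g p^-1%g).
move=> [[? ?] ?] [[? ?] ?] e1 e2.
have := ler_norm (c 1%g 1%g); have := ler_norm (- c 1%g 1%g); rewrite normrN.
by rewrite ler_norml => ? ?; apply/andP; split; lra.
Qed.

End Potential.

Lemma bounded_representative : exists (psi : G -> R) (D : R),
  forall g h, `|psi g + psi h - psi (g * h)%g + c g h| <= D.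
Proof.
have [K hK] := holonomy_compare.
exact: (bounded_representative_of_potential hK).
Qed.

End BoundedRepresentative.

Lemma hyperbolic_four_point (R : realType) (G : groupType) (S : seq G)
    (genS : generates S) :
  hyperbolic_metric (fun x y => (word_dist genS x y)%:R : R) ->
  exists delta : nat, forall w x y z,
    (word_dist genS x z + word_dist genS w y <=
      maxn (word_dist genS x y + word_dist genS w z)
           (word_dist genS y z + word_dist genS w x) + delta)%N.
Proof.
move=> [e he]; exists (Num.truncn (2 * e)).+1 => w x y z.
have := he w x y z; rewrite /gromov_product addn_maxl leq_max.
rewrite -!(ler_nat R) !natrD; have := truncnS_gt (2 * e).
by rewrite /Num.min; case: ifP => _ ? ?; apply/orP; [left|right]; lra.
Qed.

Lemma hyperbolic_cocycle_bounded (R : realType) (G : groupType)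
    (c : G -> G -> R) :
  hyperbolic_group R G -> cocycle2 c ->
  exists (psi : G -> R) (D : R),
    forall g h, `|psi g + psi h - psi (g * h)%g + c g h| <= D.
Proof.
move=> [S [genS /hyperbolic_four_point[delta hyp]]] cC.
exact: bounded_representative hyp _ cC.
Qed.

(** * From invariant quasimorphisms to 2-cocycles on the quotient *)

Section Transgression.
Variables (R : realType) (G : groupType) (N : normalSubgroup G).
Local Notation Q := (quotg N).
Local Notation pr := (\pi_Q).

Lemma repr_coset_in (g : G) : (g / repr (pr g))%g \in N.
Proof. by rewrite coset_equivE reprK. Qed.

Definition coset_part (g : G) : subgroup N :=
  Sub (g / repr (pr g))%g (repr_coset_in g).

Lemma coset_partK (g : G) : (val (coset_part g) * repr (pr g))%g = g.
Proof. by rewrite /= mulgVK. Qed.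

Lemma pi_val (u : subgroup N) : pr (val u) = 1%g.
Proof. by apply/eqP; rewrite pi_quotg_eq1 (valP u). Qed.

Lemma coset_partM (u : subgroup N) (g : G) :
  coset_part (val u * g)%g = (u * coset_part g)%g.
Proof.
by apply: val_inj; rewrite /= pi_quotgM pi_val mul1g -mulgA.
Qed.

Lemma nconj_expg (g : G) (u : subgroup N) n :
  nconj g (u ^+ n)%g = (nconj g u ^+ n)%g.
Proof.
have nconjM v w : nconj g (v * w)%g = (nconj g v * nconj g w)%g.
  by apply: val_inj; rewrite /= !mulgA mulgVK.
elim: n => [|n IHn]; last by rewrite !expgS nconjM IHn.
by apply: val_inj; rewrite /= mulg1 mulgV.
Qed.

Lemma val_expg (u : subgroup N) n : val (u ^+ n)%g = (val u ^+ n)%g.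
Proof. by elim: n => // n IHn; rewrite !expgS -IHn. Qed.

Lemma inv_hqm_quasimorphism (f : inv_hqm R N) :
  exists D, forall u v, `|(val f (u * v)%g : R) - val f u - val f v| <= D.
Proof. by have /asboolP[/asboolP[]] := valP f. Qed.

Lemma inv_hqm_conj (f : inv_hqm R N) g u : val f (nconj g u) = val f u.
Proof. by have /asboolP[_ ->] := valP f. Qed.

Lemma inv_hqm_expg (f : inv_hqm R N) u (n : nat) :
  val f (u ^+ n)%g = n%:R * val f u :> R.
Proof. by have /asboolP[/asboolP[_ /(_ u n)]] := valP f. Qed.

(* Lifts to Q(N)^G and the 2-cocycles of G/N the graph of the embedding of    *)
(* Q(N)^G / i^*Q(G) into H^2(G/N).                                            *)
Definition transgression (f : inv_hqm R N) (c : Q -> Q -> R) : Prop :=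
  exists F : G -> R,
    (exists D, forall u : subgroup N, `|F (val u) - val f u| <= D) /\
    (exists D, forall g h : G,
       `|F g + F h - F (g * h)%g - c (pr g) (pr h)| <= D).

(** On N the pulled back cocycle is constant, so F is a quasimorphism there, and f is its
    homogenization. Conjugation by a fixed g changes F by an error bounded uniformly on N, so f is
    exactly invariant. *)
Lemma transgression_hyperbolic (c : Q -> Q -> R) : hyperbolic_group R G ->
  cocycle2 c -> exists f, transgression f c.
Proof.
move=> hypG cC.
have [|psi [D hD]] := @hyperbolic_cocycle_bounded R G
    (fun g h => c (pr g) (pr h)) hypG.
  by move=> x y z; rewrite !pi_quotgM.
have [F hF] : exists F : G -> R, forall g h,
    `|F g + F h - F (g * h)%g - c (pr g) (pr h)| <= D.
  exists (fun g => - psi g) => g h; have := hD g h.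
  by rewrite !ler_norml => /andP[? ?]; apply/andP; split; lra.
have [|h [C hC]] := @homogenization R _ (fun u : subgroup N => F (val u)).
  exists (D + `|c 1%g 1%g|) => u v; have := hF (val u) (val v).
  rewrite !pi_val; have := ler_norm (c 1%g 1%g); have := ler_norm (- c 1%g 1%g).
  rewrite normrN !ler_norml => ? ? /andP[? ?].
  by rewrite [val (u * v)%g]/=; apply/andP; split; lra.
have hinv g u : val h (nconj g u) = val h u.
  have [K hK] :
      exists K, `|F g + F g^-1%g - c (pr g) (pr g^-1%g) - c 1%g 1%g| <= K.
    by eexists.
  have near v : `|(val h (nconj g v) : R) - val h v| <= 2 * D + 2 * C + K.
    have := hK; have := hC v; have := hC (nconj g v); have := hF (val v) g^-1%g.
    have := hF g (val v * g^-1)%g.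
    rewrite pi_quotgM pi_val mul1g (cocycle1g cC) mulgA.
    rewrite -[(g * val v * g^-1)%g]/(val (nconj g v)).
    move: (F (val v)) (F (val (nconj g v))) (F (val v * g^-1)%g) (F g)
      (F g^-1%g) (c (pr g) (pr g^-1%g)) (c 1%g 1%g) (val h v)
      (val h (nconj g v)) => ? ? ? ? ? ? ? ? ?.
    rewrite !ler_norml => /andP[? ?] /andP[? ?] /andP[? ?] /andP[? ?]
      /andP[? ?].
    by apply/andP; split; lra.
  apply: (@homogeneous_unique R _ (fun v => val h (nconj g v)) _ u
    (2 * D + 2 * C + K)) => [n|n|n].
  - by rewrite nconj_expg hqm_expg.
  - exact: hqm_expg.
  - exact: near.
have hP : (val h : subgroup N -> R^o) \in @inv_hqm_pred R G N.
  by apply/asboolP; split=> //; exact: valP.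
by exists (Sub (val h : subgroup N -> R^o) hP), F; split; [exists C | exists D].
Qed.

(** The coboundary of p cancels c, so F minus the pullback of p is a quasimorphism on G. On N that
    pullback is constant, so the homogenization stays near f and hence equals it. *)
Lemma transgression_extendable f c : transgression f c ->
  (exists p, forall x y, c x y = p x + p y - p (x * y)%g) ->
  exists F : hqm R G, forall u : subgroup N, val f u = val F (val u).
Proof.
move=> [F [[D1 hD1] [D2 hD2]]] [p cp].
have [|h [C hC]] := @homogenization R G (fun g => F g - p (pr g)).
  exists D2 => g h; have := hD2 g h; rewrite cp -pi_quotgM !ler_norml.
  by move=> /andP[? ?]; apply/andP; split; lra.
exists h => u.
apply: (@homogeneous_unique R _ (val f) (fun v => val h (val v)) u
  (D1 + C + `|p 1%g|)) => [n|n|n].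
- exact: inv_hqm_expg.
- by rewrite val_expg hqm_expg.
move: (u ^+ n)%g => v.
have := hD1 v; have := hC (val v); rewrite pi_val.
have := ler_norm (p 1%g); have := ler_norm (- p 1%g).
rewrite normrN !ler_norml => ? ? /andP[? ?] /andP[? ?].
by apply/andP; split; lra.
Qed.

Hypothesis acy : boundedly_acyclic R Q 3.

Lemma transgression_total f : exists c, cocycle2 c /\ transgression f c.
Proof.
have [D fD] := inv_hqm_quasimorphism f.
pose F g : R := val f (coset_part g).
(* F vanishes on the representatives, so a is the coboundary of F evaluated on them. *)
pose a (x y : Q) := - F (repr x * repr y)%g.
have FM u g : `|F (val u * g)%g - val f u - F g| <= D.
  by rewrite /F coset_partM; exact: fD.
(* Write g = n s and h = m t with s, t representatives; then gh = n (s m s^-1) (s t), and invariance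
   gives f(s m s^-1) = f(m). *)
have Fa g h : `|F g + F h - F (g * h)%g - a (pr g) (pr h)| <= 2 * D.
  set n := coset_part g; set m := coset_part h.
  have := FM (n * nconj (repr (pr g)) m)%g (repr (pr g) * repr (pr h))%g.
  have -> : (val (n * nconj (repr (pr g)) m)
      * (repr (pr g) * repr (pr h)) = g * h)%g.
    rewrite -[in RHS](coset_partK g) -[in RHS](coset_partK h) -/n -/m.
    by rewrite [val (_ * _)%g]/= !mulgA mulgVK.
  have := fD n (nconj (repr (pr g)) m); rewrite inv_hqm_conj.
  rewrite /a -[val f n]/(F g) -[val f m]/(F h).
  move: (F g) (F h) (F (g * h)%g) (F (repr (pr g) * repr (pr h))%g)
    (val f (n * nconj (repr (pr g)) m)%g) => ? ? ? ? ?.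
  by rewrite !ler_norml => /andP[? ?] /andP[? ?]; apply/andP; split; lra.
have [|b [[E bE] abC]] := bounded_coboundary2_correct acy (a := a).
  exists (8 * D) => x y z.
  have := Fa (repr y) (repr z); have := Fa (repr x * repr y)%g (repr z).
  have := Fa (repr x) (repr y * repr z)%g; have := Fa (repr x) (repr y).
  rewrite !pi_quotgM !reprK !mulgA !ler_norml.
  move=> /andP[? ?] /andP[? ?] /andP[? ?] /andP[? ?].
  by apply/andP; split; lra.
exists (fun x y => a x y - b x y); split=> //; exists F; split.
  exists (D + `|F 1%g|) => u; have := FM u 1%g; rewrite mulg1.
  have := ler_norm (F 1%g); have := ler_norm (- F 1%g).
  rewrite normrN !ler_norml => ? ? /andP[? ?].
  by apply/andP; split; lra.
exists (2 * D + E) => g h; have := Fa g h; have := bE (pr g) (pr h).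
move: (F g) (F h) (F (g * h)%g) (a (pr g) (pr h)) (b (pr g) (pr h)).
move=> ? ? ? ? ?.
by rewrite !ler_norml => /andP[? ?] /andP[? ?]; apply/andP; split; lra.
Qed.

(** E = F - Phi is bounded on N, hence close to a function p of the coset. So c minus the coboundary
    of p is a bounded cocycle on the quotient, and H^2_b = 0 makes it exact. *)
Lemma transgression_coboundary f c : cocycle2 c -> transgression f c ->
  (exists F : hqm R G, forall u : subgroup N, val f u = val F (val u)) ->
  exists p, forall x y, c x y = p x + p y - p (x * y)%g.
Proof.
move=> cC [F [[D1 hD1] [D2 hD2]]] [Phi fPhi].
have [D3 hD3] := hqm_quasimorphism Phi.
pose E g : R := F g - val Phi g; pose k := c 1%g 1%g.
have EM g h : `|E g + E h - E (g * h)%g - c (pr g) (pr h)| <= D2 + D3.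
  have := hD2 g h; have := hD3 g h; rewrite /E !ler_norml.
  by move=> /andP[? ?] /andP[? ?]; apply/andP; split; lra.
pose p (x : Q) := E (repr x).
have Ep g : `|E g - p (pr g)| <= D1 + D2 + D3 + `|k|.
  have := EM (val (coset_part g)) (repr (pr g)); have := hD1 (coset_part g).
  rewrite fPhi coset_partK pi_val (cocycle1g cC) -/k /p.
  have := ler_norm k; have := ler_norm (- k); rewrite normrN.
  rewrite -[F _ - _]/(E (val (coset_part g))) !ler_norml.
  by move=> ? ? /andP[? ?] /andP[? ?]; apply/andP; split; lra.
pose c' x y := c x y - (p x + p y - p (x * y)%g).
have [||q [_ c'q]] := @bounded_cocycle2_exact _ _ acy c'.
- by move=> x y z; have := cC x y z; rewrite /c' !mulgA; lra.
- exists (D1 + 2 * D2 + 2 * D3 + `|k|) => x y.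
  have := EM (repr x) (repr y); have := Ep (repr x * repr y)%g.
  rewrite pi_quotgM !reprK -/(p x) -/(p y) /c' !ler_norml.
  by move=> /andP[? ?] /andP[? ?]; apply/andP; split; lra.
exists (fun x => p x + q x) => x y; have := c'q x y; rewrite /c'; lra.
Qed.

End Transgression.

(** * Passage from the relation to dimensions *)

Theorem theorem1p9 (R : realType) (G : groupType) (N : normalSubgroup G) :
  boundedly_acyclic R (quotg N) 3 ->
    dim_le (nonextendable_space R N) (cohomology R (quotg N) 2) /\
    (hyperbolic_group R G ->
       dim_eq (nonextendable_space R N) (cohomology R (quotg N) 2)).
Proof.
move=> acy.
pose A n : submodClosed (cochain R (quotg N) n) := @all_cochains R (quotg N) n.
pose coc := cocycle A 2.
have cocP (z : coc) : cocycle2 (curry2 (val z)).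
  by apply/cocycle2P/eqP; have /andP[] := valP z.
have coc_of (c : quotg N -> quotg N -> R) : cocycle2 c ->
    exists z : coc, curry2 (val z) = c.
  move=> cC.
  have zP : uncurry2 c \in @cocycle_pred R (quotg N) A 2.
    by apply/andP; split=> //; apply/eqP/cocycle2P.
  by exists (Sub (uncurry2 c) zP : cocycle A 2).
pose rel (f : inv_hqm R N) (z : coc) := transgression f (curry2 (val z)).
have rel_lin a f z f' z' :
    rel f z -> rel f' z' -> rel (a *: f + f') (a *: z + z').
  move=> [F [[D1 hD1] [D2 hD2]]] [F' [[D1' hD1'] [D2' hD2']]].
  exists (fun g => a * F g + F' g); split.
    exists (`|a| * D1 + D1') => u.
    rewrite (_ : _ - _ = a * (F (val u) - val f u) + (F' (val u) - val f' u)).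
      by rewrite (le_trans (ler_normD _ _)) ?lerD ?normrM ?ler_wpM2l.
    by rewrite -[val (_ + _) u]/(a * val f u + val f' u); ring.
  exists (`|a| * D2 + D2') => g h.
  set x := \pi g; set y := \pi h.
  rewrite (_ : _ - _ = a * (F g + F h - F (g * h)%g - curry2 (val z) x y)
    + (F' g + F' h - F' (g * h)%g - curry2 (val z') x y)).
    by rewrite (le_trans (ler_normD _ _)) ?lerD ?normrM ?ler_wpM2l.
  rewrite -[curry2 (val (_ + _)) x y]/(a * curry2 (val z) x y
    + curry2 (val z') x y).
  ring.
have rel_total f : exists z, rel f z.
  have [c [cC fc]] := transgression_total acy f.
  by have [z zc] := coc_of c cC; exists z; rewrite /rel zc.
have rel_sub f z : rel f z -> (f \in @extendable R G N) =
    (z \in @coboundary_pred R (quotg N) A 2).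
  move=> fz; apply/asboolP/asboolP.
    move=> /(transgression_coboundary acy (cocP z) fz)[p zp].
    by exists (uncurry1 p) => //; exact: coboundary_curry.
  move=> [h _ zh]; apply: (transgression_extendable fz).
  by exists (fun x => h (vec [:: x])) => x y; rewrite zh curry_coboundary.
split; first exact: relation_dim_le rel_lin rel_total rel_sub.
move=> hypG; apply: (relation_dim_eq rel_lin rel_total rel_sub) => z.
exact: transgression_hyperbolic hypG (cocP z).
Qed.
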